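(* For every network $\mathbf{G}$ of diameter at most $\Delta$, every first-order formula $\psi$ with $\ell$ free variables, and every finite relation $A$ of arity $\ell$: $\mathbf{G},A\models\psi$ if and only if $\mathbf{G},A\vdash_{FO}\psi$.
   Context: Networks: $U$ is an infinite linearly ordered set of node identifiers. A network $\mathbf{G}=(V,G)$ is a finite, connected, undirected graph with $V\subset U$ and symmetric edge relation $G$, of degree bounded by a constant $D$; $n=|V|$. The model is synchronous message passing. Each node knows its own identifier, its neighbours' identifiers, $n$ and $\Delta$. In each round every node performs local computation and then broadcasts messages to all its neighbours, which receive them. A query is posed by a requesting node. Formulas are first-order over $\{G\}$ with equality and node identifiers as constants. Notation: $\mathbf{G},A\models\psi$ means $A=\{(a_1,\dots,a_\ell)\in V^\ell:\mathbf{G}\models\psi(a_1,\dots,a_\ell)\}$. $\mathbf{G},A\vdash_{FO}\psi$ means that $A$ is the union of all answers produced by the query engine $\mathcal{QE}_{FO}$ on all nodes, upon request of $\psi$ from any node. For a Boolean $\psi$, the answer is the truth value computed by the requesting node. The query engine $\mathcal{QE}_{FO}$ works as follows. - Messages and tables. It uses three kinds of messages: Boolean queries $?B\varphi$ ($\varphi$ a sentence possibly containing constants); partially instantiated queries $?x_1\dots ?x_i\,!a_{i+1}\dots !a_\ell\,\varphi(x_1,\dots,x_i,a_{i+1},\dots,a_\ell)$; and Boolean answers $!B\varphi$ (with a truth value). Each node keeps a query table of pairs (query, parent query) and an answer table. - Local simplification. Every node simplifies each formula it handles by replacing with their truth values all atoms it can decide from its local data. These are the atoms $G(b,c)$ in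 which $b$ or $c$ is its own identifier, and equalities between constants. - Handling a query. The requesting node issues the query. When a node $a$ issues or receives a query that is not yet in its query table, it records the query (with its parent), broadcasts it to its neighbours, and processes it as follows. - If the query still has free variables $x_1,\dots,x_i$, node $a$ instantiates the rightmost one, $x_i$, by its own identifier and handles the resulting subquery in the same way. When all free variables are instantiated (the last one, $x_1$, at node $a_1$), node $a_1$ issues the Boolean query $?B\varphi(a_1,\dots,a_\ell)$ and records it with parent $!a_1\dots!a_\ell\varphi(a_1,\dots,a_\ell)$. - If the query is Boolean of the form $Qx\,\psi$ with $Q\in\{\exists,\forall\}$ the leftmost quantifier, node $a$ instantiates $x$ by its own identifier, obtaining $\psi(a)$. If $\psi(a)$ is true and $Q=\exists$, this is a witness; if $\psi(a)$ is false and $Q=\forall$, this is a counterevidence. If $\psi(a)$ cannot be decided locally, it is recorded with parent $Qx\,\psi$, broadcast, and handled recursively. - Clocks and answers. A node waiting for the answer to a Boolean query sets a clock of $2\Delta w'$ rounds, where $w'$ is the number of variables and constants of that query. If a witness (resp. counterevidence) arrives, $\exists x\psi$ is true (resp. $\forall x\psi$ is false). If none arrives before the clock elapses, $\exists x\psi$ is declared false (resp. $\forall x\psi$ true). Answers are stored and broadcast, each node forwarding a given answer at most once, until they reach the nodes waiting for them; those nodes then evaluate the parent query and store and broadcast its answer. - Storing results. When the Boolean query $?B\varphi(a_1,\dots,a_\ell)$ generated from a fully instantiated query is answered positively, node $a_1$ stores $(a_1,\dots,a_\ell)$ in its answer table.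
   Formalization: The clock's w' counts occurrences of variables and constants, including the variable next to each quantifier (with distinct symbols the claim fails); the requesting node first puts ψ in prenex form; constants of ψ are identifiers of nodes in V. *)

(* Defs.v *)
From HB Require Import structures.
From mathcomp Require Import all_boot all_order.
From mathcomp Require Import finmap.

Set Implicit Arguments.
Unset Strict Implicit.
Unset Printing Implicit Defensive.

Variant quant := qex | qall.

Definition dual q := if q is qex then qall else qex.

(* Variables are de Bruijn indices. In a formula with free variables
   x_1, ..., x_l, the variable x_(i+1) is [Var i] outside all quantifiers. *)
Inductive term (U : Type) := Var of nat | Id of U.
Arguments Var {U}.

Inductive form (U : Type) :=
| Truth of bool
| Edge of term U & term U
| Equal of term U & term U
| Neg of form U
| And of form U & form U
| Or of form U & form U
| Quant of quant & form U.
Arguments Truth {U}.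

(* Unlike eq_comparable, computes. *)
Lemma eqb_comparable (T : eqType) : comparable T.
Proof.
by move=> x y; case E: (x == y); [left; exact/eqP | right=> /eqP; rewrite E].
Defined.

Lemma quant_comparable : comparable quant.
Proof. rewrite /comparable /decidable; decide equality. Defined.
HB.instance Definition _ := hasDecEq.Build quant (compareP quant_comparable).

Lemma term_comparable (U : eqType) : comparable (term U).
Proof.
rewrite /comparable /decidable; decide equality; exact: eqb_comparable.
Defined.
HB.instance Definition _ (U : eqType) :=
  hasDecEq.Build (term U) (compareP (@term_comparable U)).

Lemma form_comparable (U : eqType) : comparable (form U).
Proof.
rewrite /comparable /decidable; decide equality; exact: eqb_comparable.
Defined.
HB.instance Definition _ (U : eqType) :=
  hasDecEq.Build (form U) (compareP (@form_comparable U)).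

Section Syntax.
Variable U : Type.
Implicit Types (t : term U) (f : form U).

Definition term_below k t := if t is Var i then i < k else true.

Fixpoint free_below k f :=
  match f with
  | Truth _ => true
  | Edge s t | Equal s t => term_below k s && term_below k t
  | Neg f => free_below k f
  | And f g | Or f g => free_below k f && free_below k g
  | Quant _ f => free_below k.+1 f
  end.

Definition term_ids t := if t is Id c then [:: c] else [::].

Fixpoint ids f :=
  match f with
  | Truth _ => [::]
  | Edge s t | Equal s t => term_ids s ++ term_ids t
  | Neg f | Quant _ f => ids f
  | And f g | Or f g => ids f ++ ids g
  end.

Definition term_lift c d t :=
  if t is Var i then Var (if i < c then i else i + d) else t.

Fixpoint lift c d f :=
  match f with
  | Truth b => Truth b
  | Edge s t => Edge (term_lift c d s) (term_lift c d t)
  | Equal s t => Equal (term_lift c d s) (term_lift c d t)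
  | Neg f => Neg (lift c d f)
  | And f g => And (lift c d f) (lift c d g)
  | Or f g => Or (lift c d f) (lift c d g)
  | Quant q f => Quant q (lift c.+1 d f)
  end.

Definition term_inst k a t :=
  if t is Var i then
    if i < k then t else if i == k then Id a else Var i.-1
  else t.

Fixpoint inst k (a : U) f :=
  match f with
  | Truth b => Truth b
  | Edge s t => Edge (term_inst k a s) (term_inst k a t)
  | Equal s t => Equal (term_inst k a s) (term_inst k a t)
  | Neg f => Neg (inst k a f)
  | And f g => And (inst k a f) (inst k a g)
  | Or f g => Or (inst k a f) (inst k a g)
  | Quant q f => Quant q (inst k.+1 a f)
  end.

(* Prenex normal form: the quantifier prefix (outermost first) and the
   quantifier-free matrix. *)
Fixpoint pnf f : seq quant * form U :=
  match f with
  | Neg f => let: (p, m) := pnf f in (map dual p, Neg m)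
  | And f g =>
      let: (p, m) := pnf f in let: (p', m') := pnf g in
      (p ++ p', And (lift 0 (size p') m) (lift (size p') (size p) m'))
  | Or f g =>
      let: (p, m) := pnf f in let: (p', m') := pnf g in
      (p ++ p', Or (lift 0 (size p') m) (lift (size p') (size p) m'))
  | Quant q f => let: (p, m) := pnf f in (q :: p, m)
  | _ => ([::], f)
  end.

Definition prenex f := let: (p, m) := pnf f in foldr (@Quant U) m p.

(* The number w' of variables and constants of a formula. Occurrences are
   counted, including the one next to a quantifier: Qx f counts one more than
   each of its instances f(a), so the clock of Qx f outlasts the clocks of its
   instances by 2 Delta, a round trip in the network. *)
Fixpoint nvars_consts f :=
  match f with
  | Truth _ => 0
  | Edge _ _ | Equal _ _ => 2
  | Neg f => nvars_consts f
  | And f g | Or f g => nvars_consts f + nvars_consts g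
  | Quant _ f => (nvars_consts f).+1
  end.

(* Bounds the recursion depth of the local computations. *)
Fixpoint fsize f :=
  match f with
  | Truth _ => 1
  | Edge _ _ | Equal _ _ => 3
  | Neg f | Quant _ f => (fsize f).+1
  | And f g | Or f g => (fsize f + fsize g).+1
  end.

End Syntax.

Record network (U : choiceType) (D : nat) := Network {
  nodes : {fset U};
  edge : rel U;
  nodes_neq0 : nodes != fset0%fset;
  edge_nodes : forall u v, edge u v -> (u \in nodes) && (v \in nodes);
  edge_sym : symmetric edge;
  net_connected : {in nodes &, forall u v,
    exists2 p, path edge u p & last u p = v};
  net_degree : forall u, u \in nodes ->
    #|` [fset v in nodes | edge u v]%fset | <= D }.

Definition diameter_at_most (U : choiceType) D (N : network U D) Delta :=
  {in nodes N &, forall u v,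
    exists p, [/\ path (edge N) u p, last u p = v & size p <= Delta]}.

Section Semantics.
Variables (U : choiceType) (D : nat) (N : network U D).
Implicit Types (rho : nat -> U).

Definition tval rho (t : term U) :=
  match t with Var i => rho i | Id c => c end.

Definition extend (a : U) rho i := if i is j.+1 then rho j else a.

Fixpoint sat rho (f : form U) : Prop :=
  match f with
  | Truth b => b
  | Edge s t => edge N (tval rho s) (tval rho t)
  | Equal s t => tval rho s = tval rho t
  | Neg f => ~ sat rho f
  | And f g => sat rho f /\ sat rho g
  | Or f g => sat rho f \/ sat rho g
  | Quant qex f => exists2 a, a \in nodes N & sat (extend a rho) f
  | Quant qall f => forall a, a \in nodes N -> sat (extend a rho) f
  end.

Definition sat_tuple l (psi : form U) (a : l.-tuple U) :=
  forall rho, (forall i : 'I_l, rho i = tnth a i) -> sat rho psi.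

(* G, A |= psi *)
Definition models l (psi : form U) (A : {fset l.-tuple U}) :=
  forall a : l.-tuple U,
    a \in A <-> {subset a <= nodes N} /\ sat_tuple psi a.

End Semantics.

(* [Ask_bool f] is ?B f and [Ask_inst i [:: a_(i+1); ...; a_l] f] is
   ?x_1 ... ?x_i !a_(i+1) ... !a_l f; for i = 0 the latter only serves as the
   parent of a Boolean query and is never sent. *)
Inductive query (U : Type) :=
| Ask_bool of form U
| Ask_inst of nat & seq U & form U.

Lemma query_comparable (U : eqType) : comparable (query U).
Proof.
rewrite /comparable /decidable; decide equality; exact: eqb_comparable.
Defined.
HB.instance Definition _ (U : eqType) :=
  hasDecEq.Build (query U) (compareP (@query_comparable U)).

Inductive message (U : Type) :=
| Msg_query of query U
| Msg_answer of form U & bool.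

Record local_data (U : Type) := LocalData {
  self : U;
  nbrs : seq U;
  n_nodes : nat;
  diam : nat }.

(* The parent is [None] for a query received from a neighbour and for the
   initial non-Boolean request. *)
Record entry (U : Type) := Entry {
  e_query : query U;
  e_parent : option (query U);
  e_round : nat }.

Record state (U : Type) := State {
  queries : seq (entry U);
  answers : seq (form U * bool);
  results : seq (seq U) }.

Section Engine.
Variable U : eqType.
Implicit Types (f g : form U) (q : query U) (st : state U) (t : nat).
Implicit Types (out : seq (message U)) (p : option (query U)).

Section Node.
Variable ld : local_data U.

Definition simp_edge (s t : term U) : form U :=
  match s, t with
  | Id b, Id c =>
      if b == self ld then Truth (c \in nbrs ld)
      else if c == self ld then Truth (b \in nbrs ld)
      else Edge s t
  | _, _ => Edge s t
  end.

Definition simp_equal (s t : term U) : form U :=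
  match s, t with
  | Id b, Id c => Truth (b == c)
  | _, _ => Equal s t
  end.

Fixpoint simp f : form U :=
  match f with
  | Truth b => Truth b
  | Edge s t => simp_edge s t
  | Equal s t => simp_equal s t
  | Neg f => if simp f is Truth b then Truth (~~ b) else Neg (simp f)
  | And f g =>
      match simp f, simp g with
      | Truth b, g' => if b then g' else Truth false
      | f', Truth b => if b then f' else Truth false
      | f', g' => And f' g'
      end
  | Or f g =>
      match simp f, simp g with
      | Truth b, g' => if b then Truth true else g'
      | f', Truth b => if b then Truth true else f'
      | f', g' => Or f' g'
      end
  | Quant Q f => if simp f is Truth b then Truth b else Quant Q (simp f)
  end.

(* The query that the node generates from [q], with the parent under which it
   is recorded. A quantifier-free Boolean query generates its simplification,
   if this is a different formula. *)
Definition subquery q : option (query U * query U) :=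
  match q with
  | Ask_inst i.+1 s f =>
      let s' := self ld :: s in
      let f' := simp (inst i (self ld) f) in
      if i == 0 then Some (Ask_bool f', Ask_inst 0 s' f')
      else Some (Ask_inst i s' f', q)
  | Ask_inst 0 _ _ => None
  | Ask_bool (Quant _ f) => Some (Ask_bool (simp (inst 0 (self ld) f)), q)
  | Ask_bool f =>
      if simp f == f then None else Some (Ask_bool (simp f), q)
  end.

Definition asked st q := has (fun e => e_query e == q) (queries st).

Definition recorded st q p :=
  has (fun e => (e_query e == q) && (e_parent e == p)) (queries st).

Definition record_query st q p t :=
  State (rcons (queries st) (Entry q p t)) (answers st) (results st).

Definition decided q := if q is Ask_bool (Truth _) then true else false.

Definition broadcast_query q out :=
  if decided q then out else rcons out (Msg_query q).

(* A query already in the table is neither broadcast nor processed again, but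
   a node that issues it under a new parent remembers this parent. *)
Fixpoint handle_rec fuel t (sto : state U * seq (message U)) q p :=
  let: (st, out) := sto in
  if asked st q then
    if (p == None) || recorded st q p then sto
    else (record_query st q p t, out)
  else if fuel is fuel'.+1 then
    let sto' := (record_query st q p t, broadcast_query q out) in
    if subquery q is Some (q', p') then handle_rec fuel' t sto' q' (Some p')
    else sto'
  else sto.

Definition query_depth q :=
  match q with
  | Ask_bool f => (fsize f).+1
  | Ask_inst i _ f => (i + fsize f).+1
  end.

Definition handle t sto (qp : query U * option (query U)) :=
  handle_rec (query_depth qp.1) t sto qp.1 qp.2.

Definition answer_of st f : option bool :=
  if f is Truth b then Some b
  else ohead [seq x.2 | x <- answers st & x.1 == f].

Definition receive_answer (sto : state U * seq (message U)) (fb : form U * bool) :=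
  let: (st, out) := sto in
  if answer_of st fb.1 is Some _ then sto
  else (State (queries st) (rcons (answers st) fb) (results st),
        rcons out (Msg_answer fb.1 fb.2)).

(* The node waits for the answers to the Boolean queries it has issued, i.e.
   those it has recorded with a parent. *)
Definition clock_elapsed st t f :=
  has (fun e => [&& e_query e == Ask_bool f, e_parent e != None
                  & e_round e + 2 * diam ld * nvars_consts f <= t])
      (queries st).

Definition children st f : seq (form U) :=
  pmap (fun e => if e_query e is Ask_bool g then
                   if e_parent e == Some (Ask_bool f) then Some g else None
                 else None)
       (queries st).

(* The truth value of an instance that settles a quantified query: true for a
   witness, false for a counterevidence. *)
Definition evidence Q := if Q is qex then true else false.

Fixpoint evaluate_rec fuel st t f : option bool :=
  if answer_of st f is Some b then Some b
  else if fuel is fuel'.+1 then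
    let vals := pmap (evaluate_rec fuel' st t) (children st f) in
    if f is Quant Q _ then
      if evidence Q \in vals then Some (evidence Q)
      else if clock_elapsed st t f then Some (~~ evidence Q)
      else None
    else ohead vals
  else None.

Definition evaluate st t f := evaluate_rec (fsize f) st t f.

Definition bool_queries st : seq (form U) :=
  undup (pmap (fun e => if e_query e is Ask_bool f then Some f else None)
              (queries st)).

Definition new_answers st t : seq (form U * bool) :=
  pmap (fun f => if answer_of st f is Some _ then None
                 else omap (pair f) (evaluate st t f))
       (bool_queries st).

Definition new_results st : seq (seq U) :=
  pmap (fun e => match e_query e, e_parent e with
                 | Ask_bool f, Some (Ask_inst 0 s _) =>
                     if answer_of st f == Some true then Some s else None
                 | _, _ => None
                 end)
       (queries st).

(* One round of the node: the answers [ans] and queries [qs] at hand are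
   treated before the clocks are consulted. Returns the new state and the
   messages to broadcast. *)
Definition node_round t st (ans : seq (form U * bool))
    (qs : seq (query U * option (query U))) : state U * seq (message U) :=
  let: (st1, out1) := foldl receive_answer (st, [::]) ans in
  let: (st2, out2) := foldl (handle t) (st1, out1) qs in
  let new := new_answers st2 t in
  let st3 := State (queries st2) (answers st2 ++ new) (results st2) in
  (State (queries st3) (answers st3) (undup (results st3 ++ new_results st3)),
   out2 ++ [seq Msg_answer x.1 x.2 | x <- new]).

Definition init_state : state U := State [::] [::] [::].

Definition request_form psi : form U := simp (prenex psi).

Definition request l psi : query U * option (query U) :=
  let f := request_form psi in
  if l == 0 then (Ask_bool f, Some (Ask_inst 0 [::] f))
  else (Ask_inst l [::] f, None).

End Node.

Definition inbox_queries (ms : seq (message U)) :=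
  pmap (fun m => if m is Msg_query q then Some (q, None : option (query U))
                 else None) ms.

Definition inbox_answers (ms : seq (message U)) :=
  pmap (fun m => if m is Msg_answer f b then Some (f, b) else None) ms.

(* State of each node after round [t], and the messages it broadcasts in that
   round; they are received by its neighbours for round [t.+1]. *)
Fixpoint run (lds : U -> local_data U) (r : U) l psi t (a : U) :
    state U * seq (message U) :=
  if t is t'.+1 then
    let inbox := flatten [seq (run lds r l psi t' b).2 | b <- nbrs (lds a)] in
    node_round (lds a) t (run lds r l psi t' a).1
      (inbox_answers inbox) (inbox_queries inbox)
  else
    node_round (lds a) 0 init_state [::]
      (if a == r then [:: request (lds a) l psi] else [::]).

End Engine.

Section Derives.
Variables (U : choiceType) (D : nat) (N : network U D) (Delta : nat).

Definition net_data (a : U) : local_data U :=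
  LocalData a [seq b <- enum_fset (nodes N) | edge N a b]
    #|` nodes N | Delta.

Definition engine_state r l psi t a : state U :=
  (run net_data r l psi t a).1.

Definition computes r psi (b : bool) :=
  exists t, answer_of (engine_state r 0 psi t r)
                      (request_form (net_data r) psi) = Some b.

Definition produced r l psi (s : seq U) :=
  exists t, exists2 a, a \in nodes N & s \in results (engine_state r l psi t a).

(* G, A |-_FO psi *)
Definition derives l (psi : form U) (A : {fset l.-tuple U}) :=
  forall r, r \in nodes N ->
    if l == 0 then
      exists2 b, computes r psi b & forall a : l.-tuple U, (a \in A) = b
    else forall a : l.-tuple U, a \in A <-> produced r l psi a.

End Derives.

(* Main.v *)
(** Each formula handled by a node is equivalent, in the network, to the
    formula it comes from: prenexing, instantiation by a node and local
    simplification preserve truth. Every query and every answer is flooded, so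
    it reaches the whole network within Delta rounds.

    Completeness of the clocks: if a node issues a Boolean query [f] at round
    t0, it has a value for [f] at round t0 + 2 * Delta * w', where w' is the
    number of variables and constants of [f]. For a quantified [f] this is the
    definition of the clock. A quantifier-free [f] reaches within Delta rounds
    a node whose identifier occurs in it; this node issues a simplification
    with a smaller w' and its answer travels back within Delta rounds.

    Soundness is by induction on the round. The critical case is a clock that
    elapses without evidence. If some node b had evidence, it would have
    received [f = Qx g] by round t0 + Delta, and known the value of its
    instance [g(b)] 2 * Delta * (w' - 1) rounds later by completeness, so its
    evidence would have arrived Delta rounds later, before the clock elapsed. *)

From HB Require Import structures.
From mathcomp Require Import all_boot all_order.
From mathcomp Require Import finmap zify.
Require Import Defs.

Set Implicit Arguments.
Unset Strict Implicit.
Unset Printing Implicit Defensive.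

(** * Decidable equality for table entries and messages *)

Section Entry_eqType.
Variable U : eqType.

Definition entry_code (e : entry U) := (e_query e, e_parent e, e_round e).
Definition entry_decode (x : query U * option (query U) * nat) :=
  Entry x.1.1 x.1.2 x.2.
Lemma entry_codeK : cancel entry_code entry_decode.
Proof. by case. Qed.
HB.instance Definition _ := Equality.copy (entry U) (can_type entry_codeK).

Definition message_code (m : message U) :=
  match m with Msg_query q => inl q | Msg_answer f b => inr (f, b) end.
Definition message_decode (x : query U + form U * bool) :=
  match x with inl q => Msg_query q | inr fb => Msg_answer fb.1 fb.2 end.
Lemma message_codeK : cancel message_code message_decode.
Proof. by case. Qed.
HB.instance Definition _ :=
  Equality.copy (message U) (can_type message_codeK).
End Entry_eqType.

(** * Syntactic invariants of lifting, prenexing and instantiation *)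

Section Syntax.
Variable U : eqType.
Implicit Types (f g m : form U) (p : seq quant) (c d k : nat) (a : U).

Fixpoint qfree f :=
  match f with
  | Neg f => qfree f
  | And f g | Or f g => qfree f && qfree g
  | Quant _ _ => false
  | _ => true
  end.

Fixpoint prenexed f := if f is Quant _ g then prenexed g else qfree f.

Lemma qfree_prenexed f : qfree f -> prenexed f.
Proof. by case: f. Qed.

Lemma prenexed_foldr m p : qfree m -> prenexed (foldr (@Quant U) m p).
Proof. by move=> qm; elim: p => //=; exact: qfree_prenexed. Qed.

Lemma qfree_lift c d f : qfree (lift c d f) = qfree f.
Proof. by elim: f c => //= f IHf g IHg c; rewrite IHf IHg. Qed.

Lemma ids_lift c d f : ids (lift c d f) = ids f.
Proof.
elim: f c => //=; try by move=> [?|?] [?|?] ?.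
- by move=> f IHf g IHg c; rewrite IHf IHg.
- by move=> f IHf g IHg c; rewrite IHf IHg.
Qed.

Lemma free_below_lift c d k f :
  free_below k f -> free_below (k + d) (lift c d f).
Proof.
have tb (t : term U) e n : term_below n t -> term_below (n + d) (term_lift e d t).
  by case: t => //= i; case: ifP => _; lia.
elim: f c k => //=.
- by move=> s t c k /andP[? ?]; rewrite !tb.
- by move=> s t c k /andP[? ?]; rewrite !tb.
- by move=> f IHf g IHg c k /andP[? ?]; rewrite IHf ?IHg.
- by move=> f IHf g IHg c k /andP[? ?]; rewrite IHf ?IHg.
- by move=> _ f IHf c k; rewrite -addSn; apply: IHf.
Qed.

(** Splits one unit off a lift, for moving a formula across the quantifiers of a prefix one at a
    time. *)
Lemma lift_lift c d f : lift c d (lift c 1 f) = lift c d.+1 f.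
Proof.
have tl (t : term U) e : term_lift e d (term_lift e 1 t) = term_lift e d.+1 t.
  case: t => //= i; case: (ltnP i e) => h; rewrite ?h //.
  by rewrite ifF; [congr Var|]; lia.
by elim: f c => //= [s t|s t|f IHf|f IHf g IHg|f IHf g IHg|q f IHf] c;
  rewrite ?tl ?IHf ?IHg.
Qed.

Lemma lift_foldr c d m p :
  lift c d (foldr (@Quant U) m p) = foldr (@Quant U) (lift (c + size p) d m) p.
Proof.
by elim: p c => /= [|q p IHp] c; rewrite ?addn0 // IHp addSnnS.
Qed.

Lemma free_below_foldr k m p :
  free_below k (foldr (@Quant U) m p) = free_below (size p + k) m.
Proof. by elim: p k => //= q p IHp k; rewrite IHp addnS addSn. Qed.

Lemma ids_foldr m p : ids (foldr (@Quant U) m p) = ids m.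
Proof. by elim: p. Qed.

Lemma qfree_pnf f : qfree (pnf f).2.
Proof.
elim: f => //= [f|f + g|f + g|q f]; case: (pnf f) => //= p m qm;
  by case: (pnf g) => //= p' m'; rewrite !qfree_lift qm.
Qed.

Lemma ids_pnf f : ids (pnf f).2 = ids f.
Proof.
elim: f => //= [f|f + g|f + g|q f]; case: (pnf f) => //= p m <-;
  by case: (pnf g) => //= p' m' <-; rewrite !ids_lift.
Qed.

Lemma free_below_pnf k f :
  free_below k f -> free_below (size (pnf f).1 + k) (pnf f).2.
Proof.
have bin n p p' m m' : free_below (size p + n) m ->
    free_below (size p' + n) m' ->
    free_below (size (p ++ p') + n) (lift 0 (size p') m) &&
    free_below (size (p ++ p') + n) (lift (size p') (size p) m').
  move=> /(free_below_lift 0 (size p')) + /(free_below_lift (size p') (size p)).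
  by rewrite size_cat !(addnAC _ n) [size p' + size p]addnC => -> ->.
elim: f k => //= [f IHf|f IHf g IHg|f IHf g IHg|q f IHf] k.
- by move=> /IHf; case: (pnf f) => p m /=; rewrite size_map.
- case/andP => /IHf + /IHg; case: (pnf f) (pnf g) => p m [p' m'] /=.
  exact: bin.
- case/andP => /IHf + /IHg; case: (pnf f) (pnf g) => p m [p' m'] /=.
  exact: bin.
- by move=> /IHf; case: (pnf f) => p m /=; rewrite addnS addSn.
Qed.

Lemma prenexE f : prenex f = foldr (@Quant U) (pnf f).2 (pnf f).1.
Proof. by rewrite /prenex; case: (pnf f). Qed.

Lemma prenexed_prenex f : prenexed (prenex f).
Proof. by rewrite prenexE prenexed_foldr ?qfree_pnf. Qed.

Lemma ids_prenex f : ids (prenex f) = ids f.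
Proof. by rewrite prenexE ids_foldr ids_pnf. Qed.

Lemma free_below_prenex k f : free_below k f -> free_below k (prenex f).
Proof. by rewrite prenexE free_below_foldr; exact: free_below_pnf. Qed.

Lemma qfree_inst k a f : qfree (inst k a f) = qfree f.
Proof. by elim: f k => //= f IHf g IHg k; rewrite IHf IHg. Qed.

Lemma prenexed_inst k a f : prenexed (inst k a f) = prenexed f.
Proof.
elim: f k => //= [f IHf|f IHf g IHg|f IHf g IHg] k; by rewrite !qfree_inst.
Qed.

Lemma fsize_inst k a f : fsize (inst k a f) = fsize f.
Proof.
by elim: f k => //= [f IHf|f IHf g IHg|f IHf g IHg|q f IHf] k;
  rewrite IHf ?IHg.
Qed.

Lemma nvars_consts_inst k a f : nvars_consts (inst k a f) = nvars_consts f.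
Proof.
by elim: f k => //= [f IHf g IHg|f IHf g IHg|q f IHf] k; rewrite IHf ?IHg.
Qed.

Lemma ids_inst k a f : {subset ids (inst k a f) <= a :: ids f}.
Proof.
have ts (t : term U) n : {subset term_ids (term_inst n a t) <= a :: term_ids t}.
  case: t => [i|c] x /=; last by rewrite (in_cons a) => ->; rewrite orbT.
  by case: ifP => // _; case: ifP.
have cs (r r' s s' : seq U) : {subset r <= a :: s} -> {subset r' <= a :: s'} ->
    {subset r ++ r' <= a :: s ++ s'}.
  move=> h h' x; rewrite mem_cat inE mem_cat => /orP[/h|/h'];
  by rewrite inE => /orP[]->; rewrite ?orbT.
by elim: f k => //= *; apply: cs.
Qed.

Lemma free_below_inst j k a f :
  j <= k -> free_below k.+1 f -> free_below k (inst j a f).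
Proof.
have tb (t : term U) i n : i <= n -> term_below n.+1 t ->
    term_below n (term_inst i a t).
  case: t => //= x le_in lt_xn; case: ltngtP => //= ?; lia.
elim: f j k => //= [s t|s t|f IHf g IHg|f IHf g IHg|q f IHf] j k le_jk.
- by case/andP=> ? ?; rewrite !tb.
- by case/andP=> ? ?; rewrite !tb.
- by case/andP=> ? ?; rewrite IHf ?IHg.
- by case/andP=> ? ?; rewrite IHf ?IHg.
- exact: IHf.
Qed.

(** * Effect of local simplification on shape, size and clock length *)

Section Simp.
Variable ld : local_data U.
Local Notation simp := (simp ld).

(** Later proofs need these four outcomes only, instead of all pairs of head symbols of the two
    simplified conjuncts. *)
Lemma simp_And f g :
  [\/ simp (And f g) = Truth false, simp (And f g) = simp f,
      simp (And f g) = simp g | simp (And f g) = And (simp f) (simp g)].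
Proof.
rewrite /=; case: (simp f) => [[]|? ?|? ?|?|? ?|? ?|? ?];
  case: (simp g) => [[]|? ?|? ?|?|? ?|? ?|? ?];
  first [by constructor 1|by constructor 2|by constructor 3|by constructor 4].
Qed.

Lemma simp_Or f g :
  [\/ simp (Or f g) = Truth true, simp (Or f g) = simp f,
      simp (Or f g) = simp g | simp (Or f g) = Or (simp f) (simp g)].
Proof.
rewrite /=; case: (simp f) => [[]|? ?|? ?|?|? ?|? ?|? ?];
  case: (simp g) => [[]|? ?|? ?|?|? ?|? ?|? ?];
  first [by constructor 1|by constructor 2|by constructor 3|by constructor 4].
Qed.

Lemma simp_Neg f :
  (exists b, simp (Neg f) = Truth b) \/ simp (Neg f) = Neg (simp f).
Proof. by rewrite /=; case: (simp f) => *; [left; eexists|right..]. Qed.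

Lemma simp_Quant q f :
  (exists b, simp (Quant q f) = Truth b) \/
  simp (Quant q f) = Quant q (simp f).
Proof. by rewrite /=; case: (simp f) => *; [left; eexists|right..]. Qed.

Lemma simp_Edge s t :
  (exists b, simp (Edge s t) = Truth b) \/ simp (Edge s t) = Edge s t.
Proof.
by case: s t => [i|b] [j|c] /=; auto; do 2?case: ifP => _; eauto.
Qed.

Lemma simp_Equal s t :
  (exists b, simp (Equal s t) = Truth b) \/ simp (Equal s t) = Equal s t.
Proof. by case: s t => [i|b] [j|c] /=; eauto. Qed.

(** Simplification yields a truth value, drops one side of a connective, or rebuilds the head
    symbol. A relation stable under these three operations therefore links every formula to its
    simplification. *)
Lemma simp_ind (P : form U -> form U -> Prop) :
  (forall f b, P f (Truth b)) ->
  (forall s t, P (Edge s t) (Edge s t)) ->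
  (forall s t, P (Equal s t) (Equal s t)) ->
  (forall f f', P f f' -> P (Neg f) (Neg f')) ->
  (forall f g f', P f f' -> P (And f g) f') ->
  (forall f g g', P g g' -> P (And f g) g') ->
  (forall f g f' g', P f f' -> P g g' -> P (And f g) (And f' g')) ->
  (forall f g f', P f f' -> P (Or f g) f') ->
  (forall f g g', P g g' -> P (Or f g) g') ->
  (forall f g f' g', P f f' -> P g g' -> P (Or f g) (Or f' g')) ->
  (forall q f f', P f f' -> P (Quant q f) (Quant q f')) ->
  forall f, P f (simp f).
Proof.
move=> PT PE PQ PN PA1 PA2 PA PO1 PO2 PO PQu.
elim=> [b|s t|s t|f IHf|f IHf g IHg|f IHf g IHg|q f IHf].
- exact: PT.
- by case: (simp_Edge s t) => [[b ->]|->].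
- by case: (simp_Equal s t) => [[b ->]|->].
- by case: (simp_Neg f) => [[b ->]|->]; auto.
- by case: (simp_And f g) => ->; auto.
- by case: (simp_Or f g) => ->; auto.
- by case: (simp_Quant q f) => [[b ->]|->]; auto.
Qed.

Lemma qfree_simp f : qfree f -> qfree (simp f).
Proof.
move: f; apply: (simp_ind (P := fun f f' => qfree f -> qfree f')) => //=;
  try (by move=> f g f' IHf /andP[? ?]; apply: IHf);
  by move=> f g f' g' IHf IHg /andP[? ?]; rewrite IHf ?IHg.
Qed.

Lemma prenexed_simp f : prenexed f -> prenexed (simp f).
Proof.
elim: f => [b|s t|s t|f _|f _ g _|f _ g _|q f IHf] pf;
  try by apply/qfree_prenexed/qfree_simp.
by case: (simp_Quant q f) => [[b ->]|->] //=; exact: IHf.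
Qed.

Lemma free_below_simp k f : free_below k f -> free_below k (simp f).
Proof.
move: f k.
apply: (simp_ind
  (P := fun f f' => forall k, free_below k f -> free_below k f')) => //=;
  try (by move=> f g f' IHf k /andP[? ?]; apply: IHf);
  try (by move=> f g f' g' IHf IHg k /andP[? ?]; rewrite IHf ?IHg).
by move=> q f f' IHf k; apply: IHf.
Qed.

Lemma ids_simp f : {subset ids (simp f) <= ids f}.
Proof.
move: f; apply: (simp_ind (P := fun f f' => {subset ids f' <= ids f})) => //=;
  try (by move=> s t x);
  try (by move=> f g f' IHf x; rewrite mem_cat => /IHf->; rewrite ?orbT);
  by move=> f g f' g' IHf IHg x; rewrite !mem_cat => /orP[/IHf|/IHg] ->;
     rewrite ?orbT.
Qed.

Lemma nvars_consts_simp f : nvars_consts (simp f) <= nvars_consts f.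
Proof.
by move: f; apply: (simp_ind
  (P := fun f f' => nvars_consts f' <= nvars_consts f)) => //= *; lia.
Qed.

Lemma fsize_gt0 f : 0 < fsize f.
Proof. by case: f. Qed.

(** Each rewriting step replaces a formula by a strictly shorter one, so a formula that changes at
    all shrinks. This bounds the chains of subqueries by [fsize]. *)
Lemma fsize_simp_neq f : simp f = f \/ fsize (simp f) < fsize f.
Proof.
have e f' f1 (h : f' = f1 \/ fsize f' < fsize f1) : fsize f' <= fsize f1.
  by case: h => [->|/ltnW].
move: f.
elim=> [b|s t|s t|f IHf|f IHf g IHg|f IHf g IHg|q f IHf]; first by left.
- by case: (simp_Edge s t) => [[b ->]|->]; auto.
- by case: (simp_Equal s t) => [[b ->]|->]; auto.
- case: (simp_Neg f) => [[b ->]|->]; first by right; exact: fsize_gt0.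
  by case: IHf => [->|]; auto.
- have [lef leg] := (e _ _ IHf, e _ _ IHg).
  have [g0 g1] := (fsize_gt0 f, fsize_gt0 g).
  case: (simp_And f g) => -> /=; try by right; lia.
  by case: IHf => [->|?]; [case: IHg => [->|?]|]; [left|right..] => //; lia.
- have [lef leg] := (e _ _ IHf, e _ _ IHg).
  have [g0 g1] := (fsize_gt0 f, fsize_gt0 g).
  case: (simp_Or f g) => -> /=; try by right; lia.
  by case: IHf => [->|?]; [case: IHg => [->|?]|]; [left|right..] => //; lia.
- case: (simp_Quant q f) => [[b ->]|->]; first by right; exact: fsize_gt0.
  by case: IHf => [->|]; auto.
Qed.

Lemma fsize_simp f : fsize (simp f) <= fsize f.
Proof. by case: (fsize_simp_neq f) => [->|/ltnW]. Qed.

(** Without quantifiers and free variables every atom compares two constants. One that mentions the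
    node itself is decided, and its two occurrences leave the count. This drop pays for a round trip
    in the network. *)
Lemma nvars_consts_simp_self f : qfree f -> free_below 0 f ->
  self ld \in ids f -> nvars_consts (simp f) < nvars_consts f.
Proof.
elim: f => //= [[?|b] [?|c]|[?|b] [?|c]|f IHf|f IHf g IHg|f IHf g IHg] //=.
- by move=> _ _; rewrite !inE 2![self ld == _]eq_sym => /orP[]/eqP->;
    rewrite eqxx //; case: ifP.
- by move=> qf cf sf; have := IHf qf cf sf; case: (simp f) => //=; lia.
- move=> /andP[qf qg] /andP[cf cg]; rewrite mem_cat => h.
  have [nf ng] := (nvars_consts_simp f, nvars_consts_simp g).
  have hs : nvars_consts (simp f) < nvars_consts f \/
            nvars_consts (simp g) < nvars_consts g by case/orP: h; auto.
  by case: (simp_And f g) => /= -> /=; lia.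
- move=> /andP[qf qg] /andP[cf cg]; rewrite mem_cat => h.
  have [nf ng] := (nvars_consts_simp f, nvars_consts_simp g).
  have hs : nvars_consts (simp f) < nvars_consts f \/
            nvars_consts (simp g) < nvars_consts g by case/orP: h; auto.
  by case: (simp_Or f g) => /= -> /=; lia.
Qed.

(** With neither variables nor constants there are no atoms, only connectives of truth values. *)
Lemma simp_no_ids f : qfree f -> free_below 0 f -> ids f = [::] ->
  exists b, simp f = Truth b.
Proof.
elim: f => //= [b|[?|b] [?|c]|[?|b] [?|c]|f IHf|f IHf g IHg|f IHf g IHg] //=.
- by exists b.
- by move=> qf cf /(IHf qf cf)[b ->]; exists (~~ b).
- move=> /andP[qf qg] /andP[cf cg]; case: (ids f) IHf => //= IHf /(IHg qg cg).
  by case: (IHf qf cf erefl) => [[] ->] [b eg]; rewrite ?eg; eexists.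
- move=> /andP[qf qg] /andP[cf cg]; case: (ids f) IHf => //= IHf /(IHg qg cg).
  by case: (IHf qf cf erefl) => [[] ->] [b eg]; rewrite ?eg; eexists.
Qed.

End Simp.
End Syntax.

(** * Boolean truth, and equivalence of a formula with what becomes of it *)

Section Holds.
Variables (U : choiceType) (D : nat) (N : network U D).
Implicit Types (f g m : form U) (p : seq quant) (c d k : nat) (a : U).
Implicit Types (rho : nat -> U) (P : pred U) (Q : quant).

(** A single operator for both quantifiers, so that prenexing and the clock argument are carried out
    once for [qex] and [qall]. *)
Definition quantb Q P :=
  if Q is qex then has P (enum_fset (nodes N)) else all P (enum_fset (nodes N)).

(** Satisfaction as a boolean: quantifiers range over the finite set of nodes, so duality and case
    analysis on truth are constructive. *)
Fixpoint holds rho f : bool :=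
  match f with
  | Truth b => b
  | Edge s t => edge N (tval rho s) (tval rho t)
  | Equal s t => tval rho s == tval rho t
  | Neg f => ~~ holds rho f
  | And f g => holds rho f && holds rho g
  | Or f g => holds rho f || holds rho g
  | Quant Q f => quantb Q (fun a => holds (extend a rho) f)
  end.

Lemma satP rho f : reflect (sat N rho f) (holds rho f).
Proof.
elim: f rho => [b|s t|s t|f IHf|f IHf g IHg|f IHf g IHg|[] f IHf] rho /=.
- exact: idP.
- exact: idP.
- exact: eqP.
- by apply: (iffP idP) => [/negP h /IHf|h]; last by apply/negP => /IHf.
- by apply: (iffP andP) => -[/IHf ? /IHg ?].
- by apply: (iffP orP) => -[/IHf|/IHg]; auto.
- by apply: (iffP hasP) => -[a aN /IHf]; exists a.
- by apply: (iffP allP) => h a /h /IHf.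
Qed.

Lemma eq_quantb Q P P' : {in nodes N, P =1 P'} -> quantb Q P = quantb Q P'.
Proof. by case: Q => h; [apply: eq_in_has|apply: eq_in_all]. Qed.

Lemma quantb_dual Q P : quantb (dual Q) (fun a => ~~ P a) = ~~ quantb Q P.
Proof.
by case: Q; rewrite /quantb /= ?has_predC // -all_predC.
Qed.

(** Rests on the network having a node. It justifies simplifying a quantified truth value and moving
    a quantifier across a connective. *)
Lemma quantb_const Q (b : bool) : quantb Q (fun=> b) = b.
Proof.
have /fset0Pn[x xN] := nodes_neq0 N.
case: Q b => -[] //=.
- by apply/hasP; exists x.
- by apply/hasPn.
- by apply/allP.
- by apply/negbTE/allPn; exists x.
Qed.

Lemma quantb_evidence Q P :
  quantb Q P = evidence Q <-> exists2 a, a \in nodes N & P a = evidence Q.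
Proof.
case: Q => /=; first by split=> [/hasP|/hasP].
split=> [/negbT/allPn[a aN /negbTE]|[a aN Pa]]; first by exists a.
by apply/negbTE/allPn; exists a => //; rewrite Pa.
Qed.

Lemma eq_holds rho rho' f : rho =1 rho' -> holds rho f = holds rho' f.
Proof.
elim: f rho rho' => //= [s t|s t|f IHf|f IHf g IHg|f IHf g IHg|Q f IHf] r r' e.
- by case: s t => [?|?] [?|?] /=; rewrite ?e.
- by case: s t => [?|?] [?|?] /=; rewrite ?e.
- by rewrite (IHf _ r').
- by rewrite (IHf _ r') ?(IHg _ r').
- by rewrite (IHf _ r') ?(IHg _ r').
- by apply: eq_quantb => a _; apply: IHf; case.
Qed.

Lemma holds_free_below k rho rho' f :
  free_below k f -> (forall i, i < k -> rho i = rho' i) ->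
  holds rho f = holds rho' f.
Proof.
have tv (t : term U) n r r' : term_below n t -> (forall i, i < n -> r i = r' i) ->
  tval r t = tval r' t by case: t => //= i lt_in; apply.
elim: f k rho rho' => //= [s t|s t|f IHf|f IHf g IHg|f IHf g IHg|Q f IHf] k r r'.
- by case/andP=> ? ? e; rewrite !(tv _ k r r').
- by case/andP=> ? ? e; rewrite !(tv _ k r r').
- by move=> cf e; rewrite (IHf k _ r').
- by case/andP=> ? ? e; rewrite (IHf k _ r') ?(IHg k _ r').
- by case/andP=> ? ? e; rewrite (IHf k _ r') ?(IHg k _ r').
- by move=> cf e; apply: eq_quantb => a _; apply: (IHf k.+1) => // -[].
Qed.

Lemma holds_lift c d rho f :
  holds rho (lift c d f) = holds (fun i => rho (if i < c then i else i + d)) f.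
Proof.
have tl (t : term U) e r : tval r (term_lift e d t) =
  tval (fun i => r (if i < e then i else i + d)) t by case: t.
elim: f c rho => //= [s t|s t|f IHf|f IHf g IHg|f IHf g IHg|Q f IHf] c r;
  rewrite ?tl ?IHf ?IHg //.
apply: eq_quantb => a _; rewrite IHf; apply: eq_holds => -[|i] //=.
by rewrite ltnS; case: ifP.
Qed.

Lemma holds_inst k a rho f :
  holds rho (inst k a f) =
  holds (fun i => if i < k then rho i else if i == k then a else rho i.-1) f.
Proof.
have ti (t : term U) n r : tval r (term_inst n a t) =
    tval (fun i => if i < n then r i else if i == n then a else r i.-1) t.
  by case: t => //= i; case: ifP => //; case: ifP.
elim: f k rho => //= [s t|s t|f IHf|f IHf g IHg|f IHf g IHg|Q f IHf] k r;
  rewrite ?ti ?IHf ?IHg //.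
apply: eq_quantb => b _; rewrite IHf; apply: eq_holds => -[|i] //=.
by rewrite ltnS eqSS; case: ltngtP => //; case: i.
Qed.

Lemma holds_inst0 a rho f : holds rho (inst 0 a f) = holds (extend a rho) f.
Proof. by rewrite holds_inst; apply: eq_holds => -[]. Qed.

Lemma eq_holds_foldr rho p m m' :
  (forall rho', holds rho' m = holds rho' m') ->
  holds rho (foldr (@Quant U) m p) = holds rho (foldr (@Quant U) m' p).
Proof.
by move=> e; elim: p rho => //= Q p IHp rho; apply: eq_quantb => a _.
Qed.

Section Connective.
Variables (con : form U -> form U -> form U) (op : bool -> bool -> bool).
Hypothesis holds_con : forall rho f g,
  holds rho (con f g) = op (holds rho f) (holds rho g).
Hypothesis opC : commutative op.
Hypothesis quantb_op : forall Q P b,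
  quantb Q (fun a => op (P a) b) = op (quantb Q P) b.

(** Stated for an abstract connective, to cover [And] and [Or] at once. The lift protects the free
    variables of [g] from capture by the prefix. *)
Lemma holds_foldr_pull rho p m g :
  holds rho (foldr (@Quant U) (con m (lift 0 (size p) g)) p) =
  op (holds rho (foldr (@Quant U) m p)) (holds rho g).
Proof.
elim: p rho g => [|Q p IHp] rho g /=.
  by rewrite holds_con holds_lift; congr op; apply: eq_holds => i; rewrite addn0.
rewrite -quantb_op; apply: eq_quantb => a _.
(* The induction hypothesis is used for [g] lifted by one, which ignores the value [a] of the
   variable just bound. *)
rewrite -lift_lift IHp holds_lift; congr op; apply: eq_holds => i /=.
by rewrite addn1.
Qed.

(** Two uses of the previous lemma: the whole second formula is moved out of [p], then, inside [p],
    the matrix [m] is moved out of [p']; commutativity puts the arguments in the right order. *)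
Lemma holds_foldr_con rho p p' m m' :
  holds rho (foldr (@Quant U)
    (con (lift 0 (size p') m) (lift (size p') (size p) m')) (p ++ p')) =
  op (holds rho (foldr (@Quant U) m p)) (holds rho (foldr (@Quant U) m' p')).
Proof.
rewrite foldr_cat -holds_foldr_pull; apply: eq_holds_foldr => r.
rewrite holds_con opC lift_foldr add0n -holds_foldr_pull.
by apply: eq_holds_foldr => r'; rewrite !holds_con opC.
Qed.

End Connective.

Lemma holds_prenex rho f : holds rho (prenex f) = holds rho f.
Proof.
rewrite prenexE.
elim: f rho => [b|s t|s t|f IHf|f IHf g IHg|f IHf g IHg|Q f IHf] rho //=.
- rewrite -IHf; case: (pnf f) => p m /= {IHf}.
  by elim: p rho => //= Q p IHp rho; rewrite -quantb_dual; apply: eq_quantb.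
- rewrite -IHf -IHg; case: (pnf f) (pnf g) => p m [p' m'] /=.
  apply: holds_foldr_con => // [|Q P []]; first exact: andbC.
    by rewrite andbT; apply: eq_quantb => a; rewrite andbT.
  by rewrite andbF -[RHS](quantb_const Q); apply: eq_quantb => a; rewrite andbF.
- rewrite -IHf -IHg; case: (pnf f) (pnf g) => p m [p' m'] /=.
  apply: holds_foldr_con => // [|Q P []]; first exact: orbC.
    by rewrite orbT -[RHS](quantb_const Q); apply: eq_quantb => a; rewrite orbT.
  by rewrite orbF; apply: eq_quantb => a; rewrite orbF.
- by case: (pnf f) IHf => p m /= IHf; apply: eq_quantb.
Qed.

(** The neighbour list of [a] decides its edges exactly, since edges stay within the network;
    symmetry covers the atoms with [a] in second position. *)
Lemma holds_simp Delta rho a f :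
  a \in nodes N -> holds rho (simp (net_data N Delta a) f) = holds rho f.
Proof.
move=> aN; have nb x : (x \in nbrs (net_data N Delta a)) = edge N a x.
  rewrite mem_filter andb_idr // => /edge_nodes/andP[_]; exact.
elim: f rho => [b|s t|s t|f IHf|f IHf g IHg|f IHf g IHg|Q f IHf] rho //.
- case: s t => [i|b] [j|c] //=; case: eqP => [->|_]; first exact: nb.
  by case: eqP => [->|//]; rewrite /= edge_sym; exact: nb.
- by case: s t => [i|b] [j|c].
- by rewrite [RHS]/= -IHf /=; case: (simp _ f).
- rewrite [RHS]/= -IHf -IHg /=.
  by case: (simp _ f) => [[]|? ?|? ?|?|? ?|? ?|? ?];
    case: (simp _ g) => [[]|? ?|? ?|?|? ?|? ?|? ?] //=; rewrite ?andbT ?andbF.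
- rewrite [RHS]/= -IHf -IHg /=.
  by case: (simp _ f) => [[]|? ?|? ?|?|? ?|? ?|? ?];
    case: (simp _ g) => [[]|? ?|? ?|?|? ?|? ?|? ?] //=; rewrite ?orbT ?orbF.
- have -> : holds rho (Quant Q f) =
      holds rho (Quant Q (simp (net_data N Delta a) f)).
    by apply: eq_quantb => b _; exact/esym/IHf.
  rewrite [simp _ (Quant Q f)]/=; case: (simp _ f) => //= b.
  by rewrite quantb_const.
Qed.

End Holds.

(** * Treatment of answers and queries by one node in one round *)

Section LocalStep.
Variable U : eqType.
Implicit Types (f g : form U) (q r : query U) (p : option (query U)).
Implicit Types (st : state U) (t : nat) (out : seq (message U)).
Implicit Types (x y z : state U * seq (message U)).

Lemma askedP st q :
  reflect (exists2 e, e \in queries st & e_query e = q) (asked st q).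
Proof. by apply: (iffP hasP) => -[e eS /eqP]; exists e. Qed.

Lemma recordedP st q p :
  reflect (exists t, Entry q p t \in queries st) (recorded st q p).
Proof.
apply: (iffP hasP) => [[[q' p' t] eS /andP[/eqP/= <- /eqP/= <-]]|[t eS]].
  by exists t.
by exists (Entry q p t) => //=; rewrite !eqxx.
Qed.

Lemma recorded_asked st q p : recorded st q p -> asked st q.
Proof. by case/recordedP => t eS; apply/askedP; eexists; first exact: eS. Qed.

Lemma asked_sub st st' q :
  {subset queries st <= queries st'} -> asked st q -> asked st' q.
Proof. by move=> h /askedP[e /h ? ?]; apply/askedP; exists e. Qed.

Lemma recorded_sub st st' q p :
  {subset queries st <= queries st'} -> recorded st q p -> recorded st' q p.
Proof. by move=> h /recordedP[t /h ?]; apply/recordedP; exists t. Qed.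

Lemma answer_ofP st f b :
  answer_of st f = Some b -> f = Truth b \/ (f, b) \in answers st.
Proof.
have h g : ohead [seq fb.2 | fb <- answers st & fb.1 == g] = Some b ->
    (g, b) \in answers st.
  elim: (answers st) => //= -[g' b'] s IHs /=; case: eqP => [-> [->]|_ /IHs].
    by rewrite mem_head.
  by rewrite inE => ->; rewrite orbT.
by case: f => [b'|s t|s t|f|f g|f g|Q f] /=;
  first [by case=> ->; left|by move=> /h; right].
Qed.

Lemma answered_mem st f b : (f, b) \in answers st -> answer_of st f.
Proof.
have h g : (g, b) \in answers st ->
    ohead [seq fb.2 | fb <- answers st & fb.1 == g].
  elim: (answers st) => //= -[g' b'] s IHs; rewrite inE => /orP[/eqP[-> _]|].
    by rewrite eqxx.
  by move=> /IHs; case: ifP.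
by case: f => [b'|s t|s t|f|f g|f g|Q f];
  first [by []|exact: h].
Qed.

Lemma answered_sub st st' f :
  {subset answers st <= answers st'} -> answer_of st f -> answer_of st' f.
Proof.
move=> h; case E: (answer_of st f) => [b|//] _.
case: (answer_ofP E) => [->//|/h]; exact: answered_mem.
Qed.

Lemma mem_children st f g :
  (g \in children st f) = recorded st (Ask_bool g) (Some (Ask_bool f)).
Proof.
rewrite /children /recorded; elim: (queries st) => //= -[q p t] s IHs /=.
case: q => [g'|i r g'] //=; case: (p == _) => /=; rewrite ?andbF //.
by rewrite andbT inE IHs eq_sym; congr (_ || _); apply/eqP/eqP => [->|[]].
Qed.

Lemma mem_bool_queries st f : (f \in bool_queries st) = asked st (Ask_bool f).
Proof.
rewrite mem_undup /asked; elim: (queries st) => //= -[q p t] s IHs /=.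
case: q => [g'|i r g'] //=.
by rewrite inE IHs eq_sym; congr (_ || _); apply/eqP/eqP => [->|[]].
Qed.

(** What the treatment of incoming answers guarantees. A new answer is both stored and forwarded,
    which is what flooding relies on. *)
Variant received x y (ans : seq (form U * bool)) : Prop := Received of
  queries y.1 = queries x.1 & results y.1 = results x.1 &
  {subset answers x.1 <= answers y.1} & {subset x.2 <= y.2} &
  (forall fb, fb \in answers y.1 -> fb \in answers x.1 \/
     fb \in ans /\ Msg_answer fb.1 fb.2 \in y.2) &
  (forall m, m \in y.2 -> m \in x.2 \/
     exists2 fb, m = Msg_answer fb.1 fb.2 & fb \in answers y.1) &
  (forall fb, fb \in ans -> answer_of y.1 fb.1).

Lemma foldl_received x ans : received x (foldl (@receive_answer U) x ans) ans.
Proof.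
elim: ans x => [|fb ans IHans] x; first by split=> //; auto.
rewrite [foldl _ _ _]/=.
case: x => st out; have := IHans (receive_answer (st, out) fb).
set z := foldl _ _ _; rewrite [receive_answer _ _]/=.
case E: (answer_of st fb.1) => [b|] [/= qz rz az oz nz mz dz].
  split=> //.
  - by move=> ? /nz[|[h ?]]; [left|right]; rewrite ?inE ?h ?orbT.
  - move=> fb'; rewrite inE => /orP[/eqP->|/dz //].
    by apply: answered_sub az _; rewrite E.
split=> //.
- by move=> ? h; apply: az; rewrite mem_rcons inE h orbT.
- by move=> ? h; apply: oz; rewrite mem_rcons inE h orbT.
- move=> fb' /nz[|[h ?]]; last by right; rewrite inE h orbT.
  rewrite mem_rcons inE => /orP[/eqP->|]; last by left.
  by right; rewrite mem_head; split=> //; apply: oz; rewrite mem_rcons mem_head.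
- move=> m /mz[|]; last by right.
  rewrite mem_rcons inE => /orP[/eqP->|]; last by left.
  by right; exists fb => //; apply: az; rewrite mem_rcons mem_head.
- move=> fb'; rewrite inE => /orP[/eqP->|/dz //].
  apply: (@answered_mem _ _ fb.2); apply: az.
  by rewrite -surjective_pairing mem_rcons mem_head.
Qed.

Variable ld : local_data U.

(** Makes [query_depth] enough fuel for the whole chain of subqueries. For an unquantified Boolean
    query the decrease holds because a subquery is generated only if simplification changes the
    formula. *)
Lemma subquery_depth q q' r' :
  subquery ld q = Some (q', r') -> query_depth q' < query_depth q.
Proof.
case: q => [f|[|i] s f] //=.
  have sb g : (if simp ld g == g then None
      else Some (Ask_bool (simp ld g), Ask_bool g)) = Some (q', r') ->
      query_depth q' < (fsize g).+1.
    case: eqP => // ne [<- _] /=.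
    by case: (fsize_simp_neq ld g).
  case: f => [b|s t|s t|f|f g|f g|Q f] => [/sb|/sb|/sb|/sb|/sb|/sb|[<- _]] //=.
  by rewrite !ltnS (leq_trans (fsize_simp _ _)) ?fsize_inst.
have le : fsize (simp ld (inst i (self ld) f)) <= fsize f.
  by rewrite (leq_trans (fsize_simp _ _)) ?fsize_inst.
case: ifP => _ [<- _] /=; rewrite ?addSn !ltnS ?leq_add2l //.
by rewrite (leq_trans le) // leq_addl.
Qed.

Definition processed st q := forall q' r',
  subquery ld q = Some (q', r') -> recorded st q' (Some r').

Lemma processed_sub st st' q :
  {subset queries st <= queries st'} -> processed st q -> processed st' q.
Proof. by move=> h pq q' r' /pq; exact: recorded_sub. Qed.

(** A transitive specification, so that it passes from one query to a list of queries. [New] is an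
    invariant of the new entries: it is trivial for flooding and later becomes well-formedness. *)
Variant handled t (New : query U -> option (query U) -> Prop) x y : Prop :=
  Handled of
  answers y.1 = answers x.1 & results y.1 = results x.1 &
  {subset queries x.1 <= queries y.1} & {subset x.2 <= y.2} &
  (forall e, e \in queries y.1 -> e \in queries x.1 \/
     e_round e = t /\ New (e_query e) (e_parent e)) &
  (forall m, m \in y.2 -> m \in x.2 \/
     exists2 q, m = Msg_query q & asked y.1 q) &
  (forall q, asked y.1 q -> asked x.1 q \/
     processed y.1 q /\ (decided q \/ Msg_query q \in y.2)).

Lemma handled_refl t New x : handled t New x x.
Proof. by split=> //; auto. Qed.

Lemma handled_trans t New x y z :
  handled t New x y -> handled t New y z -> handled t New x z.
Proof.
case=> a1 r1 q1 o1 e1 m1 p1 [a2 r2 q2 o2 e2 m2 p2].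
split; rewrite ?a2 ?r2 //.
- by move=> e /q1/q2.
- by move=> m /o1/o2.
- by move=> e /e2[/e1|]; auto.
- move=> m /m2[/m1[|[q -> aq]]|]; auto.
  by right; exists q => //; apply: asked_sub q2 aq.
- move=> q /p2[/p1[|[pq dq]]|]; auto; right; split.
    exact: processed_sub q2 pq.
  by case: dq => [|/o2]; auto.
Qed.

Section NewEntries.
Variable New : query U -> option (query U) -> Prop.
Hypothesis New_subquery : forall q p q' r',
  New q p -> subquery ld q = Some (q', r') -> New q' (Some r').

Lemma handle_rec_handled fuel t x q p :
    query_depth q <= fuel -> New q p ->
  let y := handle_rec ld fuel t x q p in
  [/\ handled t New x y, asked y.1 q & p != None -> recorded y.1 q p].
Proof.
elim: fuel x q p => [|fuel IHf] [st out] q p /=; first by case: q.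
move=> le_q New_q.
have rec_new : let y := (record_query st q p t, out) in
    [/\ asked y.1 q, recorded y.1 q p & {subset queries st <= queries y.1}].
  split; rewrite ?/asked ?/recorded /= ?has_rcons /= ?eqxx //.
  by move=> e h; rewrite mem_rcons inE h orbT.
case aq: (asked st q).
  case: ifP => [/orP[/eqP->|rq]|/norP[pN rq]].
  - by split=> //; exact: handled_refl.
  - by split=> //; exact: handled_refl.
  case: rec_new => a1 r1 s1; split=> //; split=> //=; auto.
  - by move=> e; rewrite mem_rcons inE => /orP[/eqP->|]; auto.
  - move=> q'; rewrite /asked has_rcons /= => /orP[/eqP<-|]; auto.
set x' := (record_query st q p t, broadcast_query q out).
have [a1 r1 s1] := rec_new.
have sub_out : {subset out <= x'.2}.
  rewrite /= /broadcast_query => m h.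
  by case: ifP; rewrite // mem_rcons inE h orbT.
have bq : decided q \/ Msg_query q \in x'.2.
  rewrite /= /broadcast_query; case: ifP; [by left|right].
  by rewrite mem_rcons mem_head.
(* In [x'] the query [q] is recorded but not yet processed. Only this obligation is missing when the
   specification is extended back to the initial state, and the recursive call fulfils it. *)
have step y : handled t New x' y -> processed y.1 q -> handled t New (st, out) y.
  case=> a2 r2 q2 o2 e2 m2 p2 pq; split; rewrite ?a2 ?r2 //=.
  - by move=> e /s1/q2.
  - by move=> m /sub_out/o2.
  - by move=> e /e2[|]; auto; rewrite mem_rcons inE => /orP[/eqP->|]; auto.
  - move=> m /m2[|]; auto; rewrite /= /broadcast_query; case: ifP; auto.
    rewrite mem_rcons inE => _ /orP[/eqP->|]; auto; right; exists q => //.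
    exact: asked_sub q2 a1.
  - move=> q' /p2[|]; auto; rewrite /asked has_rcons /= => /orP[/eqP<-|]; auto.
    by right; split=> //; case: bq => [|/o2]; auto.
case E: (subquery ld q) => [[q' r']|]; last first.
  split=> //; apply: step; first exact: handled_refl.
  by move=> ? ?; rewrite E.
have [||h2 a2 r2] := IHf x' q' (Some r').
- by rewrite -ltnS (leq_trans (subquery_depth E)).
- exact: New_subquery New_q E.
have [_ _ q2 _ _ _ _] := h2.
split; [|exact: asked_sub q2 a1|by move=> _; exact: recorded_sub q2 r1].
by apply: step => // ? ?; rewrite E => -[<- <-]; exact: r2.
Qed.

Lemma foldl_handled t x qs :
    (forall qp, qp \in qs -> New qp.1 qp.2) ->
  let y := foldl (handle ld t) x qs in
  handled t New x y /\
  forall qp, qp \in qs ->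
    asked y.1 qp.1 /\ (qp.2 != None -> recorded y.1 qp.1 qp.2).
Proof.
elim: qs x => [|qp qs IHqs] x New_qs; first by split=> //; exact: handled_refl.
have [//||h1 a1 r1] := @handle_rec_handled (query_depth qp.1) t x qp.1 qp.2.
  by apply: New_qs; rewrite mem_head.
have [|h2 a2] := IHqs (handle ld t x qp).
  by move=> qp' h; apply: New_qs; rewrite inE h orbT.
split; first exact: handled_trans h1 h2.
have [_ _ q2 _ _ _ _] := h2.
move=> qp'; rewrite inE => /orP[/eqP->|/a2 //]; split.
  exact: asked_sub q2 a1.
by move=> /r1; exact: recorded_sub q2.
Qed.
End NewEntries.
End LocalStep.

(** * Runs of the engine in the whole network *)

Section Run.
Variables (U : choiceType) (D : nat) (N : network U D) (Delta : nat).
Hypothesis N_diameter : diameter_at_most N Delta.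
Variables (r : U) (l : nat) (psi : form U).
Hypothesis rN : r \in nodes N.
Hypothesis psi_free : free_below l psi.
Hypothesis psi_ids : {subset ids psi <= nodes N}.

Implicit Types (f g : form U) (q : query U) (a b : U) (t : nat).

Local Notation ld := (net_data N Delta).
Local Notation final := (engine_state N Delta r l psi).

Lemma mem_nbrs a b : (b \in nbrs (ld a)) = edge N a b.
Proof. by rewrite mem_filter andb_idr // => /edge_nodes/andP[_]; exact. Qed.

(** With [inbox] and [requests], puts round 0 and the later rounds under the same equation
    [runE]. *)
Definition before t a :=
  if t is t'.+1 then final t' a else @init_state U.

Definition inbox t a : seq (message U) :=
  if t is t'.+1 then
    flatten [seq (run ld r l psi t' b).2 | b <- nbrs (ld a)]
  else [::].

Definition requests t a :=
  if t is 0 then if a == r then [:: request (ld a) l psi] else [::]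
  else inbox_queries (inbox t a).

Definition listen t a :=
  foldl (@receive_answer U) (before t a, [::]) (inbox_answers (inbox t a)).

(* The node after it has treated its messages and before it consults its
   clocks; [evaluate] is called in this state. *)
Definition mid t a := foldl (handle (ld a) t) (listen t a) (requests t a).

Lemma runE t a :
  run ld r l psi t a =
  node_round (ld a) t (before t a) (inbox_answers (inbox t a)) (requests t a).
Proof. by case: t. Qed.

Lemma queries_final t a : queries (final t a) = queries (mid t a).1.
Proof.
rewrite /engine_state runE /node_round /mid /listen.
by case: (foldl _ _ (inbox_answers _)) => ? ?; case: foldl.
Qed.

Lemma answers_final t a :
  answers (final t a) =
  answers (mid t a).1 ++ new_answers (ld a) (mid t a).1 t.
Proof.
rewrite /engine_state runE /node_round /mid /listen.
by case: (foldl _ _ (inbox_answers _)) => ? ?; case: foldl.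
Qed.

Lemma results_final t a :
  results (final t a) = undup (results (mid t a).1 ++ new_results (final t a)).
Proof.
rewrite /engine_state runE /node_round /mid /listen.
by case: (foldl _ _ (inbox_answers _)) => ? ?; case: foldl.
Qed.

Lemma messages_run t a :
  (run ld r l psi t a).2 =
  (mid t a).2 ++ [seq Msg_answer x.1 x.2 | x <- new_answers (ld a) (mid t a).1 t].
Proof.
rewrite runE /node_round /mid /listen.
by case: (foldl _ _ (inbox_answers _)) => ? ?; case: foldl.
Qed.

Lemma new_answersP a st t f v :
  reflect [/\ asked st (Ask_bool f), answer_of st f = None &
              evaluate (ld a) st t f = Some v]
          ((f, v) \in new_answers (ld a) st t).
Proof.
rewrite /new_answers mem_pmap; apply: (iffP mapP) => [[g]|[af nf ef]].
  rewrite mem_bool_queries => ag; case E: (answer_of st g) => //.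
  by case E': (evaluate _ _ _ _) => //= -[-> ->].
by exists f; rewrite ?mem_bool_queries // nf ef.
Qed.

(* The tuple of values of the free variables of psi, when the last ones have
   already been instantiated by [s]. *)
Definition env i (s : seq U) (rho : nat -> U) j :=
  if j < i then rho j else nth (rho j) s (j - i).

(** * Invariants of the recorded queries *)

Definition wf_form k f :=
  [/\ free_below k f, prenexed f & {subset ids f <= nodes N}].

(** Identifiers are required to be nodes, since an atom that is stuck elsewhere must be decided by a
    node it mentions. Only partially instantiated queries are tied to [psi]; a Boolean query has a
    meaning of its own. *)
Definition wf_query q : Prop :=
  match q with
  | Ask_bool f => wf_form 0 f
  | Ask_inst i s f =>
      [/\ i + size s = l, {subset s <= nodes N}, wf_form i f &
          forall rho, holds N rho f = holds N (env i s rho) psi]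
  end.

(** A Boolean parent determines its child at [a], so the value of the child can be read as one of an
    instance or a simplification. A fully instantiated parent carries the tuple that a positive
    answer certifies. *)
Definition wf_entry a q (p : option (query U)) : Prop :=
  wf_query q /\
  match p with
  | None => True
  | Some (Ask_bool f) => subquery (ld a) (Ask_bool f) = Some (q, Ask_bool f)
  | Some (Ask_inst 0 s f) => q = Ask_bool f /\ wf_query (Ask_inst 0 s f)
  | Some (Ask_inst _ _ _) => True
  end.

Lemma wf_simp k a f : a \in nodes N -> wf_form k f -> wf_form k (simp (ld a) f).
Proof.
move=> aN [cf pf If]; split; first exact: free_below_simp.
  exact: prenexed_simp.
by move=> x /ids_simp/If.
Qed.

Lemma wf_inst k a f : a \in nodes N -> free_below k.+1 f -> prenexed f ->
  {subset ids f <= nodes N} -> wf_form k (inst k a f).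
Proof.
move=> aN cf pf If; split; first exact: free_below_inst.
  by rewrite prenexed_inst.
by move=> x /ids_inst; rewrite inE => /orP[/eqP->//|/If].
Qed.

Lemma wf_subquery a q p q' p' : a \in nodes N ->
  wf_entry a q p -> subquery (ld a) q = Some (q', p') -> wf_entry a q' (Some p').
Proof.
move=> aN [wq _] E.
have sb f : wf_form 0 f -> (if simp (ld a) f == f then None
      else Some (Ask_bool (simp (ld a) f), Ask_bool f)) = Some (q', p') ->
    wf_query q' /\ p' = Ask_bool f.
  by move=> wf; case: eqP => // ne [<- <-]; split=> //=; apply: wf_simp.
case: q wq E => [f|[|i] s f] wq E //.
  suff [wq' ep] : wf_query q' /\ p' = Ask_bool f.
    by split; rewrite // ep E ep.
  case: f wq E => [b|s t|s t|f|f g|f g|Q f] wq E; try exact: sb E.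
  case: E => <- <-; split=> //=; apply: wf_simp => //.
  by case: wq => *; apply: wf_inst.
move: wq E => /= wq E.
case: wq => es sN [cf pf If] ef.
have wf : wf_form i (simp (ld a) (inst i a f)).
  by apply: wf_simp => //; apply: wf_inst.
have esN : {subset a :: s <= nodes N}.
  by move=> x; rewrite inE => /orP[/eqP->//|/sN].
have eh rho : holds N rho (simp (ld a) (inst i a f)) =
    holds N (env i (a :: s) rho) psi.
  rewrite holds_simp // holds_inst ef; apply: (holds_free_below _ psi_free) => j.
  move=> lt_jl; rewrite /env ltnS; case: (ltngtP j i) => ji //=.
  (* The two environments use different defaults of [nth]; they agree because [j < l] keeps the
     index inside [s]. *)
  - rewrite (_ : j - i = (j - i.+1).+1); last by lia.
    by rewrite /=; apply: set_nth_default; lia.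
  - by rewrite ji subnn.
case: eqP E => [i0|_] [<- <-] /=; split=> //=.
- by subst i.
- by subst i; split=> //; split=> //; rewrite -es.
- by split=> //; rewrite -es /= addnS.
Qed.

(** * Growth of the tables and flooding of queries and answers *)

Lemma listenP t a :
  received (before t a, [::]) (listen t a) (inbox_answers (inbox t a)).
Proof. exact: foldl_received. Qed.

Lemma midP t a :
  handled (ld a) t (fun _ _ => True) (listen t a) (mid t a) /\
  forall qp, qp \in requests t a -> asked (mid t a).1 qp.1 /\
    (qp.2 != None -> recorded (mid t a).1 qp.1 qp.2).
Proof. exact: foldl_handled. Qed.

Lemma mem_inbox t a m :
  reflect (exists2 b, edge N a b & m \in (run ld r l psi t b).2)
          (m \in inbox t.+1 a).
Proof.
apply: (iffP flatten_mapP) => -[b]; first by rewrite mem_nbrs; exists b.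
by move=> ab mb; exists b; rewrite ?mem_nbrs.
Qed.

Lemma mem_inbox_answers (ms : seq (message U)) f v :
  ((f, v) \in inbox_answers ms) = (Msg_answer f v \in ms).
Proof.
rewrite /inbox_answers; elim: ms => //= -[q|g w] ms IHms //=.
by rewrite !inE IHms; congr (_ || _); apply/eqP/eqP => -[-> ->].
Qed.

Lemma mem_inbox_queries (ms : seq (message U)) q p :
  ((q, p) \in inbox_queries ms) = (p == None) && (Msg_query q \in ms).
Proof.
rewrite /inbox_queries; elim: ms => [|[q'|g w] ms IHms] //=.
  by rewrite andbF.
rewrite !inE IHms; case: p {IHms} => [p|] //=; first by rewrite !xpair_eqE andbF.
by congr (_ || _); apply/eqP/eqP => -[->].
Qed.

Lemma queries_before_mid t a :
  {subset queries (before t a) <= queries (mid t a).1}.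
Proof.
have [[_ _ sq _ _ _ _] _] := midP t a; have [eq _ _ _ _ _ _] := listenP t a.
by move=> e; rewrite -eq; exact: sq.
Qed.

Lemma queries_final_le t t' a :
  t <= t' -> {subset queries (final t a) <= queries (final t' a)}.
Proof.
elim: t' => [|t' IHt]; first by rewrite leqn0 => /eqP->.
rewrite leq_eqVlt => /orP[/eqP-> //|lt_t] e /(IHt lt_t) h.
by rewrite queries_final; exact: queries_before_mid.
Qed.

Lemma answers_before_mid t a :
  {subset answers (before t a) <= answers (mid t a).1}.
Proof.
have [[ea _ _ _ _ _ _] _] := midP t a; have [_ _ sa _ _ _ _] := listenP t a.
by move=> x; rewrite ea; exact: sa.
Qed.

Lemma answers_mid_final t a :
  {subset answers (mid t a).1 <= answers (final t a)}.
Proof. by move=> x h; rewrite answers_final mem_cat h. Qed.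

Lemma answers_mid_le t t' a :
  t <= t' -> {subset answers (mid t a).1 <= answers (mid t' a).1}.
Proof.
elim: t' => [|t' IHt]; first by rewrite leqn0 => /eqP->.
rewrite leq_eqVlt => /orP[/eqP-> //|lt_t] x /(IHt lt_t)/answers_mid_final h.
exact: answers_before_mid.
Qed.

Lemma sent_query_asked t a q :
  Msg_query q \in (run ld r l psi t a).2 -> asked (final t a) q.
Proof.
have [[_ _ _ _ _ sm _] _] := midP t a; have [_ _ _ _ _ lm _] := listenP t a.
rewrite messages_run mem_cat /asked queries_final.
case/orP=> [/sm[/lm[//|[? //]]|[q' [->] //]]|/mapP[? _ //]].
Qed.

Lemma sent_answer_known t a f v :
  Msg_answer f v \in (run ld r l psi t a).2 -> (f, v) \in answers (final t a).
Proof.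
have [[ea _ _ _ _ sm _] _] := midP t a; have [_ _ _ _ _ lm _] := listenP t a.
rewrite messages_run answers_final !mem_cat ea.
case/orP=> [/sm[/lm[//|[[g w] [-> ->] -> //]]|[? //]]|/mapP[[g w] + [-> ->]]].
by move=> ->; rewrite orbT.
Qed.

Lemma asked_final t a q : asked (final t a) q ->
  asked (before t a) q \/
  processed (ld a) (final t a) q /\
  (decided q \/ Msg_query q \in (run ld r l psi t a).2).
Proof.
have [[_ _ _ _ _ _ sp] _] := midP t a; have [eq _ _ _ _ _ _] := listenP t a.
rewrite {1}/asked queries_final => /sp[|[pq dq]].
  by rewrite /asked eq; left.
right; split; first by apply: processed_sub pq; rewrite queries_final.
by rewrite messages_run mem_cat; case: dq => [|->]; auto.
Qed.

Lemma asked_processed t a q :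
  asked (final t a) q -> processed (ld a) (final t a) q.
Proof.
elim: t => [|t IHt] /asked_final[|[]//] //= /IHt.
by apply: processed_sub; exact: queries_final_le.
Qed.

(** In the round in which [a] first asks [q] it broadcasts it, unless [q] is decided; [b] has it one
    round later and tables only grow. *)
Lemma asked_edge t a b q : edge N a b -> ~~ decided q ->
  asked (final t a) q -> asked (final t.+1 b) q.
Proof.
move=> ab dq.
have sent t1 : Msg_query q \in (run ld r l psi t1 a).2 -> asked (final t1.+1 b) q.
  move=> mq; have [_ /(_ (q, None))] := midP t1.+1 b.
  rewrite mem_inbox_queries eqxx /=.
  case; first by apply/mem_inbox; exists a; rewrite // edge_sym.
  by move=> + _; rewrite /asked queries_final.
elim: t => [|t IHt] /asked_final[|[_ [/(negP dq)|/sent]]] //=.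
by move=> /IHt; apply: asked_sub; exact: queries_final_le.
Qed.

Lemma asked_everywhere t a b q : a \in nodes N -> b \in nodes N ->
  ~~ decided q -> asked (final t a) q -> asked (final (t + Delta) b) q.
Proof.
move=> aN bN dq aq; have [p [pp <- le_p]] := N_diameter aN bN.
apply: (@asked_sub _ (final (t + size p) (last a p))).
  by apply: queries_final_le; rewrite leq_add2l.
elim: p a t aq pp {aN le_p bN} => [|c p IHp] a t aq /=; first by rewrite addn0.
by case/andP=> ac pp; rewrite -addSnnS; apply: IHp pp; exact: asked_edge aq.
Qed.

Lemma answers_final_sent t a f v : (f, v) \in answers (final t a) ->
  (f, v) \in answers (before t a) \/
  Msg_answer f v \in (run ld r l psi t a).2.
Proof.
have [[ea _ _ so _ _ _] _] := midP t a; have [_ _ _ _ nl _ _] := listenP t a.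
rewrite answers_final messages_run !mem_cat ea => /orP[/nl[|[_ /so ->]]|h]; auto.
by right; apply/orP; right; apply/mapP; exists (f, v).
Qed.

(** The receiver knows the answer already in state [mid], so an answer that arrives in the very
    round in which a clock elapses is still in time. *)
Lemma answered_edge t a b f : edge N a b ->
  answer_of (final t a) f -> answer_of (mid t.+1 b).1 f.
Proof.
move=> ab; case E: (answer_of _ f) => [v|//] _.
case: (answer_ofP E) => [->//|{E}].
have sent t1 : Msg_answer f v \in (run ld r l psi t1 a).2 ->
    answer_of (mid t1.+1 b).1 f.
  move=> mf; have [[ea _ _ _ _ _ _] _] := midP t1.+1 b.
  have [_ _ _ _ _ _ /(_ (f, v))] := listenP t1.+1 b.
  rewrite mem_inbox_answers => known.
  apply: answered_sub (known _); first by rewrite ea.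
  by apply/mem_inbox; exists a; rewrite // edge_sym.
elim: t => [|t IHt] /answers_final_sent[|/sent] //=.
by move=> /IHt; apply: answered_sub; exact: answers_mid_le.
Qed.

Lemma answered_everywhere t t' a b f : a \in nodes N -> b \in nodes N -> a != b ->
  answer_of (final t a) f -> t + Delta <= t' -> answer_of (mid t' b).1 f.
Proof.
move=> aN bN neq_ab af le_t'; have [p [pp lp le_p]] := N_diameter aN bN.
apply: (@answered_sub _ (mid (t + size p) b).1).
  by apply: answers_mid_le; rewrite (leq_trans _ le_t') ?leq_add2l.
(* The empty path is excluded by [a != b]: an answer in the final state of a round need not be
   present in the earlier state [mid]. *)
case: p pp lp {le_p le_t'} => [|c p] /=.
  by move=> _ /eqP; rewrite (negbTE neq_ab).
move=> + <- {bN neq_ab aN}; elim: p a c t af => [|c' p IHp] a c t af /=.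
  by rewrite andbT addn1 => /answered_edge; apply.
case/andP=> ac pp; rewrite -addSnnS; apply: IHp pp.
by apply: answered_sub (answered_edge ac af); exact: answers_mid_final.
Qed.

Lemma Delta_gt0 a b : a \in nodes N -> b \in nodes N -> a != b -> 0 < Delta.
Proof.
move=> aN bN neq_ab; have [[|c p] [_ /= lp le_p]] := N_diameter aN bN.
  by rewrite lp eqxx in neq_ab.
exact: leq_ltn_trans le_p.
Qed.

(** The stamp is the round in which the entry was made, so an elapsed clock shows that its query was
    asked that long ago. *)
Lemma entry_round t a e : e \in queries (final t a) ->
  e_round e <= t /\ e \in queries (final (e_round e) a).
Proof.
have nr t1 : e \in queries (final t1 a) ->
    e \in queries (before t1 a) \/ e_round e = t1.
  have [[_ _ _ _ ne _ _] _] := midP t1 a; have [eq _ _ _ _ _ _] := listenP t1 a.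
  by rewrite queries_final => /ne[|[]]; rewrite ?eq; auto.
elim: t => [|t IHt] eS; first by case: (nr _ eS) => [//|->].
case: (nr _ eS) => [/IHt[le_e ?]|->] //.
by split=> //; exact: leqW.
Qed.

Lemma wf_request : wf_entry r (request (ld r) l psi).1 (request (ld r) l psi).2.
Proof.
have wfr : wf_form l (request_form (ld r) psi).
  apply: wf_simp => //; split; first exact: free_below_prenex.
    exact: prenexed_prenex.
  by rewrite ids_prenex.
have er rho s : size s = 0 ->
    holds N rho (request_form (ld r) psi) = holds N (env l s rho) psi.
  move=> /size0nil->; rewrite holds_simp // holds_prenex.
  by apply: (holds_free_below _ psi_free) => i lt_il; rewrite /env lt_il.
rewrite /request; case: eqP => l0 /=; split=> //=.
- by rewrite -l0.
- split=> //; split=> //; first by rewrite -l0.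
  by move=> rho; rewrite (er _ [::]) // l0.
- by split=> //; [rewrite addn0|move=> rho; rewrite (er _ [::])].
Qed.

(** A query from a neighbour is recorded without parent, so only [wf_query], which does not depend
    on the node, has to survive the transfer. *)
Lemma wf_queries t a e : a \in nodes N -> e \in queries (final t a) ->
  wf_entry a (e_query e) (e_parent e).
Proof.
have mid_wf t1 a1 : a1 \in nodes N ->
    (forall qp, qp \in requests t1 a1 -> wf_entry a1 qp.1 qp.2) ->
    (forall e, e \in queries (before t1 a1) ->
       wf_entry a1 (e_query e) (e_parent e)) ->
    forall e, e \in queries (final t1 a1) -> wf_entry a1 (e_query e) (e_parent e).
  move=> aN wr wb e1; have [||] := @foldl_handled _ (ld a1) (wf_entry a1) _ t1
    (listen t1 a1) (requests t1 a1); [|exact: wr|].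
    by move=> ? ? ? ?; exact: wf_subquery.
  case=> _ _ _ _ ne _ _ _; have [eq _ _ _ _ _ _] := listenP t1 a1.
  by rewrite queries_final => /ne[|[]//]; rewrite eq; exact: wb.
elim: t a e => [|t IHt] a e aN.
  apply: mid_wf => //= qp; case: eqP => // ->; rewrite inE => /eqP->.
  exact: wf_request.
apply: mid_wf => //= [[q p]|e1]; last exact: IHt.
rewrite mem_inbox_queries => /andP[/eqP-> /mem_inbox[b ab]].
move=> /sent_query_asked/askedP[e1 e1S <-] /=; split=> //.
have /andP[_ bN] := edge_nodes ab.
by case: (IHt _ _ bN e1S).
Qed.

(** * Completeness of the clocks *)

Lemma evaluated_answered t a f : asked (final t a) (Ask_bool f) ->
  evaluate (ld a) (mid t a).1 t f -> answer_of (final t a) f.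
Proof.
move=> af; case E: (evaluate _ _ _ _) => [v|//] _.
case E': (answer_of (mid t a).1 f) => [w|].
  by apply: answered_sub (_ : answer_of (mid t a).1 f);
    [exact: answers_mid_final|rewrite E'].
apply: (@answered_mem _ _ _ v); rewrite answers_final mem_cat.
apply/orP; right; apply/new_answersP; split=> //.
by move: af; rewrite /asked queries_final.
Qed.

Lemma clock_elapsedP t a f : reflect
  (exists e, [/\ e \in queries (final t a), e_query e = Ask_bool f,
     e_parent e != None & e_round e + 2 * Delta * nvars_consts f <= t])
  (clock_elapsed (ld a) (mid t a).1 t f).
Proof.
rewrite /clock_elapsed -queries_final; apply: (iffP hasP) => [[e eS]|[e [eS]]].
  by case/and3P=> /eqP *; exists e.
by move=> *; exists e => //; apply/and3P; split=> //; exact/eqP.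
Qed.

Lemma clock_asked t a f : clock_elapsed (ld a) (mid t a).1 t f ->
  exists2 t0, asked (final t0 a) (Ask_bool f) &
              t0 + 2 * Delta * nvars_consts f <= t.
Proof.
case/clock_elapsedP => e [/entry_round[_ eS] eq _ le_t]; exists (e_round e) => //.
by apply/askedP; exists e.
Qed.

(** A node generates the subquery in the same round as it first asks the query, so the clock of the
    child starts no later than [t0]. *)
Lemma child_clock t0 t a f g : asked (final t0 a) (Ask_bool f) ->
    subquery (ld a) (Ask_bool f) = Some (Ask_bool g, Ask_bool f) ->
    t0 + 2 * Delta * nvars_consts g <= t ->
  g \in children (mid t a).1 f /\ clock_elapsed (ld a) (mid t a).1 t g.
Proof.
move=> /asked_processed pf /pf rg le_t.
have le_t0 : t0 <= t by lia.
rewrite mem_children /recorded -queries_final; split.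
  exact: recorded_sub (queries_final_le le_t0) rg.
case/recordedP: rg => t1 eS; apply/clock_elapsedP.
exists (Entry (Ask_bool g) (Some (Ask_bool f)) t1); split=> //=.
  exact: queries_final_le eS.
by have [/= le_t1 _] := entry_round eS; lia.
Qed.

Lemma mem_vals a st t n f g v : g \in children st f ->
  evaluate_rec (ld a) n st t g = Some v ->
  v \in pmap (evaluate_rec (ld a) n st t) (children st f).
Proof. by move=> gc eg; rewrite mem_pmap; apply/mapP; exists g. Qed.

Definition quantified f := if f is Quant _ _ then true else false.

Lemma evaluate_rec_child a st t n f g :
  ~~ quantified f -> g \in children st f ->
  evaluate_rec (ld a) n st t g -> evaluate_rec (ld a) n.+1 st t f.
Proof.
move=> nq gc; case E: (evaluate_rec _ _ _ _ g) => [v|//] _ /=.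
case: (answer_of st f) => //.
have := mem_vals gc E.
by case: pmap; case: f nq {gc}.
Qed.

Lemma evaluate_rec_evidence a st t n Q h g :
  g \in children st (Quant Q h) ->
  evaluate_rec (ld a) n st t g = Some (evidence Q) ->
  evaluate_rec (ld a) n.+1 st t (Quant Q h).
Proof. by move=> gc eg /=; case: ohead => //; rewrite (mem_vals gc eg). Qed.

Lemma subquery_unquantified a f : ~~ quantified f ->
  subquery (ld a) (Ask_bool f) =
  if simp (ld a) f == f then None
  else Some (Ask_bool (simp (ld a) f), Ask_bool f).
Proof. by case: f. Qed.

(** The query travels for [Delta] rounds, a clock of weight [m] elapses, and the answer travels back
    for [Delta] rounds: all this fits into a clock of weight [n]. *)
Lemma round_trip_le t0 t m n : m < n -> t0 + 2 * Delta * n <= t ->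
  t0 + Delta + 2 * Delta * m + Delta <= t.
Proof.
move=> lt_mn; apply: leq_trans; rewrite -!addnA leq_add2l.
apply: leq_trans (leq_mul (leqnn (2 * Delta)) lt_mn).
by rewrite mulnS addnCA addnn -mul2n addnC.
Qed.

(** The induction on the fuel leaves node and round free, because a formula stuck at [a] is
    evaluated by another node at an earlier round. *)
Lemma evaluate_complete n t a f : a \in nodes N -> fsize f <= n ->
  clock_elapsed (ld a) (mid t a).1 t f ->
  evaluate_rec (ld a) n (mid t a).1 t f.
Proof.
elim/ltn_ind: n t a f => -[|n] IHn t a f aN le_f ck.
  by case: f le_f {ck}.
case E: (answer_of (mid t a).1 f) => [v|]; first by rewrite /= E.
have [nq|] := boolP (~~ quantified f); last first.
  by case: f ck E {le_f} => //= Q f ck -> _; rewrite ck; case: ifP.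
have [t0 af le_t] := clock_asked ck.
have [e eS eq] := askedP _ _ af.
have [] := wf_queries aN eS; rewrite eq => -[cf pf If] _ {e eS eq}.
have qf : qfree f by case: f nq pf {le_f ck E af le_t cf If}.
have dq : ~~ decided (Ask_bool f).
  by case: f E {le_f ck af le_t cf pf If nq qf}.
have sn := subquery_unquantified _ nq.
have lt_s b : simp (ld b) f <> f -> fsize (simp (ld b) f) < fsize f.
  by move=> ne; case: (fsize_simp_neq (ld b) f).
have [sf|/eqP sf] := eqVneq (simp (ld a) f) f; last first.
  have := sn a; rewrite ifF; last exact/eqP.
  move=> sa; have [|gc gk] := child_clock (t := t) af sa.
    apply: leq_trans le_t; rewrite leq_add2l leq_mul2l orbC.
    by rewrite nvars_consts_simp.
  apply: evaluate_rec_child gc _ => //; apply: IHn => //.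
  by rewrite -ltnS; exact: leq_trans (lt_s _ sf) le_f.
(* Now [f] is stuck at [a]. It mentions some node [b], as otherwise it would be a truth value and
   have an answer. *)
case Ef : (ids f) => [|b s].
  by have [v fv] := simp_no_ids (ld a) qf cf Ef; rewrite -sf fv in E.
have bf : b \in ids f by rewrite Ef mem_head.
have bN := If _ bf.
have lt_n : nvars_consts (simp (ld b) f) < nvars_consts f.
  exact: nvars_consts_simp_self.
have sb : simp (ld b) f <> f by move=> eb; rewrite eb ltnn in lt_n.
have neq_ba : b != a by apply/eqP => ba; rewrite ba in sb.
have bq := asked_everywhere aN bN dq af.
have := sn b; rewrite ifF; last exact/eqP.
set g := simp _ f => sbq.
(* A round by which [b] has received [f] and the clock of its child [g] has elapsed. *)
set tb := t0 + Delta + 2 * Delta * nvars_consts g.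
have [//|gc gk] := child_clock (t := tb) bq sbq.
have eb : evaluate (ld b) (mid tb b).1 tb f.
  (* The fuel of [evaluate] is [fsize f], possibly less than [n.+1]; hence the strong induction. *)
  rewrite /evaluate -(prednK (fsize_gt0 f)).
  apply: evaluate_rec_child gc _ => //; apply: IHn => //.
    by rewrite prednK ?fsize_gt0.
  by rewrite -ltnS prednK ?fsize_gt0 //; exact: lt_s.
have bqb : asked (final tb b) (Ask_bool f).
  by apply: asked_sub bq; apply: queries_final_le; rewrite leq_addr.
have le_tb : tb + Delta <= t by exact: round_trip_le lt_n le_t.
have := answered_everywhere bN aN neq_ba (evaluated_answered bqb eb) le_tb.
by rewrite E.
Qed.

(** * Soundness of the answers *)

Lemma child_subquery t a f g : a \in nodes N ->
  g \in children (mid t a).1 f ->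
  subquery (ld a) (Ask_bool f) = Some (Ask_bool g, Ask_bool f).
Proof.
move=> aN; rewrite mem_children /recorded -queries_final.
by case/recordedP=> t0 /(wf_queries aN)[].
Qed.

Definition sound (s : seq (form U * bool)) :=
  forall f v, (f, v) \in s -> forall rho, holds N rho f = v.

Lemma answer_of_sound st f v rho :
  sound (answers st) -> answer_of st f = Some v -> holds N rho f = v.
Proof. by move=> ss /answer_ofP[->//|/ss]. Qed.

(** Before consulting its clocks, a node holds only answers that it or a neighbour stored in the
    preceding round. *)
Lemma mid_sound t a : a \in nodes N ->
  (forall t' b, t' < t -> b \in nodes N -> sound (answers (final t' b))) ->
  sound (answers (mid t a).1).
Proof.
move=> aN IHt f v; have [[-> _ _ _ _ _ _] _] := midP t a.
have [_ _ _ _ nl _ _] := listenP t a.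
case: t IHt nl => [|t] IHt nl /nl[//|[]] //=; first exact: IHt.
rewrite mem_inbox_answers => /mem_inbox[b ab /sent_answer_known h] _.
by have /andP[_ bN] := edge_nodes ab; exact: IHt h.
Qed.

(** Two nested inductions: on the fuel for the children at the same node and round, and on the round
    for the value that another node found earlier. *)
Lemma evaluate_sound t : (forall t' a, t' <= t -> a \in nodes N ->
    sound (answers (mid t' a).1)) ->
  forall a n f v rho, a \in nodes N -> fsize f <= n ->
  evaluate_rec (ld a) n (mid t a).1 t f = Some v -> holds N rho f = v.
Proof.
elim/ltn_ind: t => t IHt mid_s a n f v rho aN.
have {}IHt t' : t' < t -> forall a n f v rho, a \in nodes N -> fsize f <= n ->
    evaluate_rec (ld a) n (mid t' a).1 t' f = Some v -> holds N rho f = v.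
  move=> lt_t; apply: IHt => // t1 a1 le_t1; apply: mid_s.
  exact: leq_trans le_t1 (ltnW lt_t).
elim: n f v rho => [|n IHn] f v rho le_f; first by case: f le_f.
rewrite /=; case E: (answer_of _ f) => [w|].
  by case=> <-; apply: answer_of_sound E; exact: mid_s.
set vals := pmap _ _.
have memv g w : g \in children (mid t a).1 f ->
    evaluate_rec (ld a) n (mid t a).1 t g = Some w -> w \in vals.
  exact: mem_vals.
have valsP w : w \in vals -> exists2 g,
    subquery (ld a) (Ask_bool f) = Some (Ask_bool g, Ask_bool f) &
    forall rho', holds N rho' g = w.
  rewrite mem_pmap => /mapP[g gc eg]; have sg := child_subquery aN gc.
  exists g => // rho'; apply: IHn (esym eg).
  by have := subquery_depth sg => /=; lia.
clearbody vals; have [nq|] := boolP (~~ quantified f).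
  have -> : (if f is Quant Q _ then
      if evidence Q \in vals then Some (evidence Q)
      else if clock_elapsed (ld a) (mid t a).1 t f then Some (~~ evidence Q)
      else None else ohead vals) = ohead vals by case: (f) nq.
  case: vals valsP {memv} => // w s /(_ w (mem_head _ _))[g] + eg [<-].
  rewrite subquery_unquantified //; case: eqP => // _ [sg].
  by rewrite -(eg rho) -sg holds_simp.
move=> isq; have [Q [h ef]] : exists Q h, f = Quant Q h.
  by case: (f) isq => // Q h _; exists Q, h.
subst f => /=; case: ifP => [/valsP[g [<-]] eg [<-]|nev].
  apply/quantb_evidence; exists a => //.
  by rewrite -(eg rho) holds_simp // holds_inst0.
(* The clock elapsed without evidence. If the declared value were wrong, some node [b] would carry
   evidence. *)
case: ifP => // ck [<-]; apply/eqP/negPn/negP => neg.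
have /quantb_evidence[b bN hb] :
    quantb N Q (fun b => holds N (extend b rho) h) = evidence Q.
  by move: neg; case: (quantb _ _ _); case: (evidence Q).
have [t0 af le_t] := clock_asked ck.
set g := simp (ld b) (inst 0 b h).
have sg : subquery (ld b) (Ask_bool (Quant Q h)) =
  Some (Ask_bool g, Ask_bool (Quant Q h)) by [].
have hg : holds N rho g = evidence Q by rewrite holds_simp // holds_inst0.
have le_ng : nvars_consts g <= nvars_consts h.
  by rewrite (leq_trans (nvars_consts_simp _ _)) ?nvars_consts_inst.
have le_g : fsize g <= fsize h.
  by rewrite (leq_trans (fsize_simp _ _)) ?fsize_inst.
(* If [b] is [a], the evidence is among the values of its own children. *)
have [ba|neq_ba] := eqVneq b a.
  subst b; have [|gc gk] := child_clock (t := t) af sg.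
    apply: leq_trans le_t; rewrite leq_add2l leq_mul2l; apply/orP; right.
    exact: leqW.
  have := evaluate_complete (n := n) aN _ gk.
  case eg: evaluate_rec => [w|] /(_ _); last by move=> /(_ (leq_trans le_g le_f)).
  have := IHn _ _ rho (leq_trans le_g le_f) eg; rewrite hg => ew _.
  by move: nev; rewrite ew (memv _ _ gc eg).
have dq : ~~ decided (Ask_bool (Quant Q h)) by [].
have bq := asked_everywhere aN bN dq af.
set tb := t0 + Delta + 2 * Delta * nvars_consts g.
have [//|gc gk] := child_clock (t := tb) bq sg.
(* A positive [Delta] makes [tb] strictly earlier than [t], as the induction on the round
   demands. *)
have gt0 := Delta_gt0 bN aN neq_ba.
have le_tb : tb + Delta <= t by apply: round_trip_le le_t.
have lt_tb : tb < t by apply: leq_trans le_tb; rewrite -addn1 leq_add2l.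
have eb : evaluate (ld b) (mid tb b).1 tb (Quant Q h).
  have := evaluate_complete bN le_g gk.
  case eg: evaluate_rec => [w|//] _; apply: (evaluate_rec_evidence gc).
  by rewrite eg -hg (IHt tb lt_tb b _ _ _ rho bN le_g eg).
have bqb : asked (final tb b) (Ask_bool (Quant Q h)).
  by apply: asked_sub bq; apply: queries_final_le; rewrite leq_addr.
(* What reaches [a] is the answer of [b] to the quantified query itself, although [a] has none by
   [E]. *)
have := answered_everywhere bN aN neq_ba (evaluated_answered bqb eb) le_tb.
by rewrite E.
Qed.

Lemma final_sound t a : a \in nodes N -> sound (answers (final t a)).
Proof.
elim/ltn_ind: t a => t IHt a aN f v.
have mid_s t' b : t' <= t -> b \in nodes N -> sound (answers (mid t' b).1).
  move=> le_t' bN; apply: mid_sound => // t1 b1 lt_t1; apply: IHt.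
  exact: leq_trans lt_t1 le_t'.
rewrite answers_final mem_cat => /orP[|/new_answersP[_ _ ev] rho].
  exact: mid_s.
exact: evaluate_sound ev.
Qed.

(** Completeness provides a value once the clock of [f] has elapsed, and soundness identifies it. *)
Lemma recorded_answered t0 a f p : a \in nodes N ->
    recorded (final t0 a) (Ask_bool f) (Some p) ->
  exists t, [/\ recorded (final t a) (Ask_bool f) (Some p) &
    forall rho, answer_of (final t a) f = Some (holds N rho f)].
Proof.
move=> aN rf; pose t := t0 + 2 * Delta * nvars_consts f; exists t.
have rft : recorded (final t a) (Ask_bool f) (Some p).
  by apply: recorded_sub rf; apply: queries_final_le; rewrite leq_addr.
split=> // rho.
have ck : clock_elapsed (ld a) (mid t a).1 t f.
  case/recordedP: rf => t1 eS; apply/clock_elapsedP.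
  exists (Entry (Ask_bool f) (Some p) t1); split=> //=.
    by apply: queries_final_le eS; rewrite leq_addr.
  by have [/= le_t1 _] := entry_round eS; rewrite leq_add2r.
have ev := evaluate_complete aN (leqnn _) ck.
have := evaluated_answered (recorded_asked rft) ev.
case E: answer_of => [v|//] _; congr Some.
by rewrite (answer_of_sound rho (final_sound aN) E).
Qed.

(** * From the request to the answer tables *)

Lemma request_asked : asked (final 0 r) (request (ld r) l psi).1 /\
  ((request (ld r) l psi).2 != None ->
   recorded (final 0 r) (request (ld r) l psi).1 (request (ld r) l psi).2).
Proof.
have [_ /(_ (request (ld r) l psi))] := midP 0 r.
by rewrite /= eqxx mem_head /asked /recorded queries_final; apply.
Qed.

Lemma results_mid t a : results (mid t a).1 = results (before t a).
Proof.
by have [[_ -> _ _ _ _ _] _] := midP t a; have [_ -> _ _ _ _ _] := listenP t a.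
Qed.

Lemma results_sound t a s : a \in nodes N -> s \in results (final t a) ->
  [/\ size s = l, {subset s <= nodes N} &
      forall rho, holds N (env 0 s rho) psi].
Proof.
move=> aN; have new_sound t1 : s \in new_results (final t1 a) ->
    [/\ size s = l, {subset s <= nodes N} &
        forall rho, holds N (env 0 s rho) psi].
  rewrite mem_pmap => /mapP[e /(wf_queries aN)[]].
  case: (e_query e) => // f _; case: (e_parent e) => // -[//|[|//] s' f'].
  move=> [[<-] [es sN _ ef]]; case: eqP => // af [->]; split=> // rho.
  by rewrite -ef (answer_of_sound rho (final_sound aN) af).
by elim: t => [|t IHt]; rewrite results_final mem_undup mem_cat results_mid;
  case/orP => [|/new_sound].
Qed.

(** By induction on the suffix: its head [b] receives the query instantiated by the rest,
    instantiates the rightmost variable by itself, and the result floods the network. For [i = 0]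
    nothing is sent. *)
Lemma instances_asked i s : 0 < i -> i + size s = l -> {subset s <= nodes N} ->
  exists t f, forall a, a \in nodes N -> asked (final t a) (Ask_inst i s f).
Proof.
elim: s i => [|b s IHs] i i_gt0 es sN.
  exists Delta, (request_form (ld r) psi) => a aN.
  rewrite -[Delta]add0n; apply: asked_everywhere rN aN _ _ => //.
  have [+ _] := request_asked.
  rewrite addn0 in es; rewrite /request -es; by case: i i_gt0 {es}.
have bN : b \in nodes N by apply: sN; rewrite mem_head.
have [||| t [f aq]] := IHs i.+1; rewrite ?addSnnS //.
  by move=> x xs; apply: sN; rewrite inE xs orbT.
exists (t + Delta), (simp (ld b) (inst i b f)) => a aN.
apply: (asked_everywhere bN aN) => //.
apply: recorded_asked; apply: (asked_processed (aq b bN)) => /=.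
by case: i i_gt0 {es aq}.
Qed.

Lemma tuple_recorded s : 0 < l -> size s = l -> {subset s <= nodes N} ->
  exists t f, exists2 a, a \in nodes N &
    recorded (final t a) (Ask_bool f) (Some (Ask_inst 0 s f)).
Proof.
case: s => [|b s] l_gt0 es sN; first by rewrite -es in l_gt0.
have bN : b \in nodes N by apply: sN; rewrite mem_head.
have [|x xs|t [f aq]] := @instances_asked 1 s isT; first by rewrite -es.
  by apply: sN; rewrite inE xs orbT.
exists t, (simp (ld b) (inst 0 b f)), b => //.
exact: (asked_processed (aq b bN)).
Qed.

Lemma producedP s : 0 < l ->
  produced N Delta r l psi s <->
  [/\ size s = l, {subset s <= nodes N} &
      forall rho, holds N (env 0 s rho) psi].
Proof.
move=> l_gt0; split=> [[t [a aN sr]]|[es sN hs]]; first exact: results_sound sr.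
have [t0 [f [a aN rf]]] := tuple_recorded l_gt0 es sN.
have [t [rft af]] := recorded_answered aN rf.
exists t, a => //; rewrite results_final mem_undup mem_cat; apply/orP; right.
rewrite mem_pmap; apply/mapP; case/recordedP: rft => t1 eS.
eexists; first exact: eS.
have [_ [_ [_ _ _ ef]]] := wf_queries aN eS.
by rewrite /= (af (fun=> r)) ef hs.
Qed.

Lemma computesP v : l = 0 ->
  computes N Delta r psi v <-> forall rho, holds N rho psi = v.
Proof.
move=> l0; have hf rho : holds N rho (request_form (ld r) psi) = holds N rho psi.
  by rewrite holds_simp // holds_prenex.
(* Writing the arity 0 of the run as [l] makes the facts about runs of arity [l] applicable. *)
rewrite /computes -l0; split=> [[t ans] rho|hv].
  by rewrite -hf (answer_of_sound rho (final_sound rN) ans).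
have eq0 : (l == 0) = true by rewrite l0.
have [_] := request_asked; rewrite /request eq0 => /(_ isT) rf.
have [t [_ af]] := recorded_answered rN rf.
by exists t; rewrite (af (fun=> r)) hf hv.
Qed.
End Run.

(** * Equivalence of truth and derivation *)

Theorem theorem2 (disp : Order.disp_t) (U : orderType disp)
    (U_infinite : forall s : seq U, exists u : U, u \notin s)
    (D : nat) (N : network U D) (Delta : nat)
    (N_diameter : diameter_at_most N Delta)
    (l : nat) (psi : form U)
    (psi_free : free_below l psi)
    (psi_ids : {subset ids psi <= nodes N})
    (A : {fset l.-tuple U}) :
  models N psi A <-> derives N Delta psi A.
Proof.
(* [derives] speaks of every requesting node; the converse direction needs one to exist. *)
have /fset0Pn[r0 r0N] := nodes_neq0 N.
(* Any assignment that extends [a] agrees with [env 0 a rho] below [l], hence on all free variables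
   of [psi]. *)
have tupleP (a : l.-tuple U) :
    sat_tuple N psi a <-> forall rho, holds N (env 0 a rho) psi.
  split=> [sa rho|ha rho e].
    apply/satP; apply: sa => i; rewrite /env subn0 (tnth_nth (rho i)) //.
  apply/satP.
  rewrite (holds_free_below (rho' := env 0 a rho) N psi_free) ?ha // => i lt_il.
  by move: (e (Ordinal lt_il)); rewrite (tnth_nth (rho i)) /env subn0.
rewrite /derives; case: eqP => [l0|/eqP l_neq0].
  (* For arity 0 the truth of [psi] depends neither on the tuple nor on the assignment. *)
  have nil_env rho (a : l.-tuple U) :
      holds N (env 0 a rho) psi = holds N rho psi.
    by apply: (holds_free_below _ psi_free) => i; rewrite [X in _ < X]l0.
  have nil_sub (a : l.-tuple U) : {subset a <= nodes N}.
    by move=> x /tnthP[[i lt_il] _]; have := lt_il; rewrite [X in _ < X]l0.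
  have const rho rho' : holds N rho psi = holds N rho' psi.
    by apply: (holds_free_below _ psi_free) => i; rewrite [X in _ < X]l0.
  split=> [mA r rN|dA a].
    exists (holds N (fun=> r) psi).
      by apply/(computesP N_diameter rN psi_free psi_ids).
    move=> a; apply/idP/idP => [/mA[_ /tupleP/(_ (fun=> r))]|ha].
      by rewrite nil_env.
    apply/mA; split; first exact: nil_sub.
    by apply/tupleP => rho; rewrite nil_env (const _ (fun=> r)).
  have [v] := dA r0 r0N.
  move=> /(computesP N_diameter r0N psi_free psi_ids _ l0) hv ->.
  split=> [vT|[_ /tupleP/(_ (fun=> r0))]]; last by rewrite nil_env hv.
  by split=> //; apply/tupleP => rho; rewrite nil_env hv.
have prodP r (a : l.-tuple U) : r \in nodes N ->
    produced N Delta r l psi a <-> {subset a <= nodes N} /\ sat_tuple N psi a.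
  move=> rN; rewrite (producedP N_diameter rN psi_free psi_ids) ?lt0n //.
  split=> [[_ sN /tupleP]|[sN /tupleP ha]]; first by [].
  by rewrite size_tuple.
split=> [mA r rN a|dA a].
  exact: iff_trans (mA a) (iff_sym (prodP r a rN)).
exact: iff_trans (dA r0 r0N a) (prodP r0 a r0N).
Qed.
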